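(* Let $k>0$ and let $T$ be an endomorphism of $O([-1,1])$ which verifies the $\mathfrak{A}(k)$ property, and let $\widetilde{T}$ be the endomorphism of $G_k([-1,1])$ induced by $T$. Then for every $u\in O([-1,1])$ the function series $\sum_{n\ge 0} T^{\langle n\rangle}(u)|_{[-1,1]}$ is uniformly convergent on $[-1,1]$, and its sum $v$ is a solution, belonging to the Gevrey class $G_k([-1,1])$, of the linear functional equation $$\Phi-\widetilde{T}(\Phi)=u\quad\text{on }[-1,1].$$
   Context: Fix a real number $k>0$. For $S\subset\mathbb{C}$ nonempty and $f:S\to\mathbb{C}$, $\|f\|_{\infty,S}=\sup_{z\in S}|f(z)|$ (possibly $+\infty$). $O(S)$ is the set of functions holomorphic on some neighborhood of $S$; in particular $O([-1,1])$ is the complex vector space of germs of holomorphic functions on $[-1,1]$. For $A>0$ and an integer $n\ge1$, $[-1,1]_{k,A,n}=\{z\in\mathbb{C}: \inf_{t\in[-1,1]}|z-t|<A n^{-1/k}\}$. This set is open, connected and contains $[-1,1]$, so an element of $O([-1,1]_{k,A,n})$ is identified with the germ it defines in $O([-1,1])$. The Gevrey class $G_k([-1,1])$ is the set of $C^\infty$ functions $f:[-1,1]\to\mathbb{C}$ for which there exist $C>0$, $A>0$ with $\|f^{(n)}\|_{\infty,[-1,1]}\le C A^n n^{n(1+1/k)}$ for all integers $n\ge0$ (with $0^0=1$). An endomorphism ($\mathbb{C}$-linear map) $T:O([-1,1])\to O([-1,1])$ verifies the $\mathfrak{A}(k)$ property if there exist constants $\tau>0$ and $\rho\in(0,1)$,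 depending only on $T$, such that for every $A\in(0,\tau]$ there exists an integer $N(A)\geq 1$ depending only on $A$ with: (i) $T(O([-1,1]_{k,A,n}))\subset O([-1,1]_{k,A,n+1})$ for all $n\ge N(A)$; (ii) $\|T(f)\|_{\infty,[-1,1]_{k,A,n+1}}\le\rho\,\|f\|_{\infty,[-1,1]_{k,A,n}}$ for all $n\ge N(A)$ and $f\in O([-1,1]_{k,A,n})$; and moreover (iii) $\|T(f)|_{[-1,1]}\|_{\infty,[-1,1]}\le\rho\,\|f|_{[-1,1]}\|_{\infty,[-1,1]}$ for all $f\in O([-1,1])$. A sequence $(f_n)_{n\ge1}$ in $O([-1,1])$ is a $k$-sequence if there exist $B>0$, $C>0$, $\theta\in(0,1)$ such that for every $n\ge1$: $f_n\in O([-1,1]_{k,B,n})$ and $\|f_n\|_{\infty,[-1,1]_{k,B,n}}\le C\theta^n$. It is known that a $C^\infty$ function $F$ on $[-1,1]$ belongs to $G_k([-1,1])$ if and only if $F=\sum_{n\ge1}f_n|_{[-1,1]}$ for some $k$-sequence $(f_n)$. If $T$ verifies the $\mathfrak{A}(k)$ property, the induced endomorphism $\widetilde{T}$ of $G_k([-1,1])$ is the unique linear endomorphism such that $\widetilde{T}\left(\sum_{n\ge1}f_n|_{[-1,1]}\right)=\sum_{n\ge1}T(f_n)|_{[-1,1]}$ for every $k$-sequence $(f_n)_{n\ge1}$. $T^{\langle n\rangle}$ denotes the $n$-th iterate of $T$ under composition ($T^{\langle 0\rangle}=\mathrm{id}$). *)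

(* Defs.v *)
From Stdlib Require Export Reals.
From Coquelicot Require Export Coquelicot.

Open Scope R_scope.

Definition II (t : R) : Prop := -1 <= t <= 1.

Definition IC (z : C) : Prop := exists t : R, II t /\ z = RtoC t.

Definition sup_norm {X : Type} (S : X -> Prop) (f : X -> C) : Rbar :=
  Lub_Rbar (fun r => exists x, S x /\ r = Cmod (f x)).

(** [[-1,1]_{k,A,n}]; only meaningful for [1 <= n], as [Rpower] requires a
    positive base. *)
Definition tube (k A : R) (n : nat) (z : C) : Prop :=
  Rbar_lt (Glb_Rbar (fun r => exists t : R, II t /\ r = Cmod (z - RtoC t)%C))
          (Finite (A * Rpower (INR n) (- (1 / k)))).

(** [O(S)]: functions are total, but only the values near [S] matter. *)
Definition holo (S : C -> Prop) (f : C -> C) : Prop :=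
  exists U : C -> Prop,
    open U /\ (forall z, S z -> U z) /\
    (forall z, U z -> @ex_derive C_AbsRing C_NormedModule f z).

(** The space of germs [O([-1,1])] is the setoid of functions satisfying
    [holo IC], with equality [germ_eq]. *)
Definition germ_eq (f g : C -> C) : Prop :=
  exists U : C -> Prop,
    open U /\ (forall z, IC z -> U z) /\ (forall z, U z -> f z = g z).

Definition germ_endomorphism (T : (C -> C) -> (C -> C)) : Prop :=
  (forall f, holo IC f -> holo IC (T f)) /\
  (forall f g, holo IC f -> holo IC g -> germ_eq f g -> germ_eq (T f) (T g)) /\
  (forall f g, holo IC f -> holo IC g ->
     germ_eq (T (fun z => f z + g z)%C) (fun z => T f z + T g z)%C) /\
  (forall (c : C) f, holo IC f ->
     germ_eq (T (fun z => c * f z)%C) (fun z => c * T f z)%C).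

(** The germ of [f] belongs to [O(S)], for [S] containing [[-1,1]], and [g] is
    the corresponding element of [O(S)].  When [S] is a [tube], the values of
    [g] on [S] are determined by the germ, since [S] is open and connected. *)
Definition germ_on (S : C -> Prop) (f g : C -> C) : Prop :=
  holo S g /\ germ_eq f g.

Definition A_property (k : R) (T : (C -> C) -> (C -> C)) : Prop :=
  exists tau rho : R,
    0 < tau /\ 0 < rho < 1 /\
    (forall A : R, 0 < A <= tau ->
       exists N : nat, (1 <= N)%nat /\
         (forall n : nat, (N <= n)%nat ->
            forall f, holo (tube k A n) f ->
              exists g, germ_on (tube k A (S n)) (T f) g) /\
         (forall n : nat, (N <= n)%nat ->
            forall f g, holo (tube k A n) f ->
              germ_on (tube k A (S n)) (T f) g ->
              Rbar_le (sup_norm (tube k A (S n)) g)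
                      (Rbar_mult (Finite rho) (sup_norm (tube k A n) f)))) /\
    (forall f, holo IC f ->
       Rbar_le (sup_norm IC (T f)) (Rbar_mult (Finite rho) (sup_norm IC f))).

(** Sequences are indexed by [n >= 1]; the value [f 0] is ignored. *)
Definition k_sequence (k : R) (f : nat -> C -> C) : Prop :=
  exists B Cst theta : R,
    0 < B /\ 0 < Cst /\ 0 < theta < 1 /\
    forall n : nat, (1 <= n)%nat ->
      exists g, germ_on (tube k B n) (f n) g /\
        Rbar_le (sup_norm (tube k B n) g) (Finite (Cst * theta ^ n)).

(** Functions on [[-1,1]] are functions on [R] up to equality on [II].
    [F] is the sequence of successive derivatives of [f] on [[-1,1]], which are
    one-sided at the endpoints: [is_derive] with the neighbourhood filter
    restricted to [[-1,1]]. *)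
Definition successive_derivatives (f : R -> C) (F : nat -> R -> C) : Prop :=
  (forall x, II x -> F O x = f x) /\
  (forall (n : nat) (x : R), II x ->
     @filterdiff R_AbsRing R_NormedModule C_R_NormedModule
       (F n) (within II (locally x))
       (fun y : R => @scal R_Ring C_R_ModuleSpace y (F (S n) x))).

(** [Rpower 0 0 = 1], as required for [n = 0]. *)
Definition gevrey (k : R) (f : R -> C) : Prop :=
  exists F : nat -> R -> C,
    successive_derivatives f F /\
    exists Cst A : R, 0 < Cst /\ 0 < A /\
      forall n : nat,
        Rbar_le (sup_norm II (F n))
          (Finite (Cst * A ^ n * Rpower (INR n) (INR n * (1 + 1 / k)))).

Definition eq_on_II (f g : R -> C) : Prop := forall x, II x -> f x = g x.

Definition gevrey_endomorphism (k : R) (Tt : (R -> C) -> (R -> C)) : Prop :=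
  (forall f, gevrey k f -> gevrey k (Tt f)) /\
  (forall f g, gevrey k f -> gevrey k g -> eq_on_II f g ->
     eq_on_II (Tt f) (Tt g)) /\
  (forall f g, gevrey k f -> gevrey k g ->
     eq_on_II (Tt (fun x => f x + g x)%C) (fun x => Tt f x + Tt g x)%C) /\
  (forall (c : C) f, gevrey k f ->
     eq_on_II (Tt (fun x => c * f x)%C) (fun x => c * Tt f x)%C).

Definition restr (f : C -> C) (x : R) : C := f (RtoC x).

Definition sums_to (f : nat -> C -> C) (F : R -> C) : Prop :=
  forall x, II x ->
    @is_series C_AbsRing C_NormedModule (fun n => restr (f (S n)) x) (F x).

Definition induced_endomorphism (k : R) (T : (C -> C) -> (C -> C))
    (Tt : (R -> C) -> (R -> C)) : Prop :=
  gevrey_endomorphism k Tt /\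
  forall (f : nat -> C -> C) (F : R -> C),
    k_sequence k f -> sums_to f F -> sums_to (fun n => T (f n)) (Tt F).

Definition series_cvu_on_II (f : nat -> R -> C) (v : R -> C) : Prop :=
  forall eps : R, 0 < eps ->
    exists N : nat, forall n : nat, (N <= n)%nat -> forall x, II x ->
      Cmod (@sum_n C_AbelianGroup (fun j => f j x) n - v x)%C < eps.

(* Main.v *)
Require Import Defs.
From Stdlib Require Import Lra Lia Psatz ClassicalEpsilon.

(** By (i) and (ii), [T^n u] is bounded by [M rho^n] on the tube of index [N + n]; since
    [N + n <= N (n + 1)], the sequence [n |-> T^(n-1) u] is a k-sequence, with sum [v].
    Applying the definition of the induced endomorphism to it gives [Tt v = v - u].

    That [v] is Gevrey needs Cauchy's estimates.  Goursat's theorem on rectangles, in the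
    coordinate [w] with [z = z0 + exp w], shows that the integral of [h (z0 + r e^(it)) e^(-it) / r]
    over [0 <= t <= 2 pi] does not depend on [r]; letting [r] tend to [0], it equals
    [2 pi h' (z0)].  Applied [p] times on discs of radius [d / (p + 1)], this bounds
    [h^(p)] on [[-1,1]] by [M (2 (p + 1) / d)^p]; then one sums over the k-sequence, using
    [n^q e^(-cn) <= (q / c)^q]. *)

(** * Goursat's theorem on rectangles *)

(** Holomorphy provides a complex derivative at each point and nothing about its continuity.
    Cauchy's formula must therefore start from Goursat's bisection, and the differentiability of the
    derivative is a theorem of its own ([derivative_differentiable]), required before the estimate
    can be iterated. In the coordinate [w] an annulus around [z0] becomes a rectangle whose vertical
    sides are the two circles, so rectangles are the only contours that occur.

    In the Gevrey bound the factor [theta ^ n] has to pay twice. With [eta = sqrt theta], one factor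
    [eta ^ n] absorbs the growth [n^(p/k)] caused by the shrinking radius [B n^(-1/k)], at the price
    of [p^(p/k)]. The other one keeps the series of bounds convergent for every [p]. Cauchy's
    estimates contribute the remaining [p^p], up to a geometric factor, whence the exponent
    [p (1 + 1/k)]. *)

Definition cderiv (f : C -> C) (z l : C) : Prop :=
  forall eps : R, 0 < eps -> exists d : R, 0 < d /\
    forall w : C, Cmod (w - z) < d ->
      Cmod (f w - f z - l * (w - z)) <= eps * Cmod (w - z).

Lemma is_derive_cderiv (f : C -> C) (z l : C) :
  @is_derive C_AbsRing C_NormedModule f z l <-> cderiv f z l.
Proof.
  split.
  - intros [_ H] eps Heps.
    destruct (H z (fun P HP => HP) (mkposreal _ Heps)) as [d Hd].
    exists d. split; [apply cond_pos|]. intros w Hw.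
    assert (E := Hd w Hw). rewrite (Cmult_comm l). exact E.
  - intros H. split.
    + apply (is_linear_scal_l (K:=C_AbsRing) (V:=C_NormedModule) l).
    + intros x Hx.
      assert (E := @is_filter_lim_locally_unique C_AbsRing (AbsRing_NormedModule C_AbsRing) z x Hx).
      subst x. clear Hx.
      intros eps. destruct (H eps (cond_pos eps)) as [d [Hd0 Hd]].
      exists (mkposreal d Hd0). intros w Hw.
      assert (E := Hd w Hw). rewrite (Cmult_comm l) in E. exact E.
Qed.

Lemma Cmod_le_Rabs (z : C) : Cmod z <= Rabs (fst z) + Rabs (snd z).
Proof.
  rewrite (surjective_pairing z) at 1. unfold Cmod; simpl.
  rewrite <- (sqrt_pow2 (Rabs (fst z) + Rabs (snd z))).
  2: { generalize (Rabs_pos (fst z)) (Rabs_pos (snd z)); lra. }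
  apply sqrt_le_1_alt.
  generalize (Rabs_pos (fst z)) (Rabs_pos (snd z)) (pow2_abs (fst z)) (pow2_abs (snd z)).
  nra.
Qed.

Lemma Rabs_fst_le (z : C) : Rabs (fst z) <= Cmod z.
Proof. apply Rle_trans with (2 := Rmax_Cmod z). apply Rmax_l. Qed.

Lemma Rabs_snd_le (z : C) : Rabs (snd z) <= Cmod z.
Proof. apply Rle_trans with (2 := Rmax_Cmod z). apply Rmax_r. Qed.

(** [open] refers to the product uniform structure of [C], whose balls are squares, whereas [cderiv]
    uses discs. A disc lies in the square of the same radius and contains that of half the
    radius. *)
Lemma open_Cmod (U : C -> Prop) :
  open U <-> forall z, U z -> exists d, 0 < d /\ forall w, Cmod (w - z) < d -> U w.
Proof.
  split.
  - intros H z Hz. destruct (H z Hz) as [d Hd].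
    exists d. split; [apply cond_pos|]. intros w Hw. apply Hd.
    split.
    + apply Rle_lt_trans with (2 := Hw). apply (Rabs_fst_le (w - z)).
    + apply Rle_lt_trans with (2 := Hw). apply (Rabs_snd_le (w - z)).
  - intros H z Hz. destruct (H z Hz) as [d [Hd0 Hd]].
    assert (Hd2 : 0 < d / 2) by lra.
    exists (mkposreal _ Hd2). intros w [H1 H2]. apply Hd.
    apply Rle_lt_trans with (1 := Cmod_le_Rabs _).
    assert (Rabs (fst (w - z)%C) < d / 2) by exact H1.
    assert (Rabs (snd (w - z)%C) < d / 2) by exact H2.
    lra.
Qed.

(** * Integrals and continuity of complex functions of a real variable *)

Definition ex_CInt (f : R -> C) (a b : R) : Prop :=
  ex_RInt (fun t => fst (f t)) a b /\ ex_RInt (fun t => snd (f t)) a b.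

Definition CInt (f : R -> C) (a b : R) : C :=
  (RInt (fun t => fst (f t)) a b, RInt (fun t => snd (f t)) a b).

Lemma CInt_ext (f g : R -> C) (a b : R) :
  a <= b -> (forall t, a <= t <= b -> f t = g t) -> CInt f a b = CInt g a b.
Proof.
  intros Hab H. unfold CInt. f_equal; apply RInt_ext; intros x Hx;
  rewrite Rmin_left, Rmax_right in Hx by lra; rewrite H by lra; reflexivity.
Qed.

Lemma ex_CInt_minus (f g : R -> C) (a b : R) :
  ex_CInt f a b -> ex_CInt g a b -> ex_CInt (fun t => f t - g t)%C a b.
Proof.
  intros [H1 H2] [H3 H4].
  split; [exact (ex_RInt_minus _ _ _ _ H1 H3)|exact (ex_RInt_minus _ _ _ _ H2 H4)].
Qed.

Lemma CInt_minus (f g : R -> C) (a b : R) :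
  ex_CInt f a b -> ex_CInt g a b ->
  CInt (fun t => f t - g t)%C a b = (CInt f a b - CInt g a b)%C.
Proof.
  intros [H1 H2] [H3 H4]. unfold CInt.
  apply injective_projections; simpl.
  - exact (RInt_minus _ _ _ _ H1 H3).
  - exact (RInt_minus _ _ _ _ H2 H4).
Qed.

(** Makes the general bound on the norm of an integral available for [Cmod], without the loss that
    bounding each coordinate would cause. *)
Lemma is_RInt_CInt (f : R -> C) (a b : R) :
  ex_CInt f a b -> @is_RInt C_R_NormedModule f a b (CInt f a b).
Proof.
  intros [H1 H2].
  apply (is_RInt_fct_extend_pair (U:=R_NormedModule) (V:=R_NormedModule) f);
  apply (RInt_correct (V:=R_CompleteNormedModule)); assumption.
Qed.

Lemma norm_C_R (z : C) : @norm R_AbsRing C_R_NormedModule z = Cmod z.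
Proof.
  unfold norm; simpl. unfold prod_norm, Cmod, norm; simpl.
  unfold abs; simpl. f_equal.
  generalize (pow2_abs (fst z)) (pow2_abs (snd z)); simpl; lra.
Qed.

Lemma Cmod_CInt_le (f : R -> C) (a b M : R) :
  a <= b -> ex_CInt f a b -> (forall t, a <= t <= b -> Cmod (f t) <= M) ->
  Cmod (CInt f a b) <= (b - a) * M.
Proof.
  intros Hab Hf HM. rewrite <- norm_C_R.
  apply (norm_RInt_le_const (V:=C_R_NormedModule) f a b _ M Hab).
  - intros x Hx. rewrite norm_C_R. auto.
  - now apply is_RInt_CInt.
Qed.

Lemma CInt_Chasles (f : R -> C) (a b c : R) :
  ex_CInt f a b -> ex_CInt f b c -> CInt f a c = (CInt f a b + CInt f b c)%C.
Proof.
  intros [H1 H2] [H3 H4]. unfold CInt. apply injective_projections; simpl; symmetry.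
  - apply (RInt_Chasles (V:=R_CompleteNormedModule)); assumption.
  - apply (RInt_Chasles (V:=R_CompleteNormedModule)); assumption.
Qed.

Lemma ex_CInt_mult (c : C) (f : R -> C) (a b : R) :
  ex_CInt f a b -> ex_CInt (fun t => c * f t)%C a b.
Proof.
  intros [H1 H2]. split; simpl.
  - apply (ex_RInt_minus (V:=R_NormedModule) (fun t => fst c * fst (f t)) (fun t => snd c * snd (f t)));
    apply (ex_RInt_scal (V:=R_NormedModule)); assumption.
  - apply (ex_RInt_plus (V:=R_NormedModule) (fun t => fst c * snd (f t)) (fun t => snd c * fst (f t)));
    apply (ex_RInt_scal (V:=R_NormedModule)); assumption.
Qed.

Lemma CInt_mult (c : C) (f : R -> C) (a b : R) :
  ex_CInt f a b -> CInt (fun t => c * f t)%C a b = (c * CInt f a b)%C.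
Proof.
  intros [H1 H2]. unfold CInt.
  assert (S : forall (k : R) g, ex_RInt g a b -> ex_RInt (fun t => k * g t) a b)
    by (intros; apply (ex_RInt_scal (V:=R_NormedModule)); assumption).
  assert (E : forall (k : R) g, ex_RInt g a b -> RInt (fun t => k * g t) a b = k * RInt g a b)
    by (intros; apply (RInt_scal (V:=R_CompleteNormedModule)); assumption).
  apply injective_projections; simpl.
  - rewrite <- !E by assumption.
    apply (RInt_minus (V:=R_CompleteNormedModule) (fun t => fst c * fst (f t)) (fun t => snd c * snd (f t))); auto.
  - rewrite <- !E by assumption.
    apply (RInt_plus (V:=R_CompleteNormedModule) (fun t => fst c * snd (f t)) (fun t => snd c * fst (f t))); auto.
Qed.

Lemma ex_CInt_const (c : C) (a b : R) : ex_CInt (fun _ => c) a b.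
Proof. split; apply ex_RInt_const. Qed.

Lemma CInt_const (c : C) (a b : R) : CInt (fun _ => c) a b = (RtoC (b - a) * c)%C.
Proof.
  unfold CInt. rewrite !RInt_const. apply injective_projections; simpl;
  unfold scal; simpl; unfold mult; simpl; ring.
Qed.

Definition ccont (f : R -> C) (t : R) : Prop :=
  forall eps, 0 < eps -> exists d, 0 < d /\
    forall s, Rabs (s - t) < d -> Cmod (f s - f t) < eps.

Lemma ex_CInt_ccont (f : R -> C) (a b : R) :
  a <= b -> (forall t, a <= t <= b -> ccont f t) -> ex_CInt f a b.
Proof.
  intros Hab H.
  split; apply (ex_RInt_continuous (V:=R_CompleteNormedModule)); intros t Ht;
  rewrite Rmin_left, Rmax_right in Ht by lra;
  apply filterlim_locally; intros eps;
  destruct (H t Ht eps (cond_pos eps)) as [d [Hd0 Hd]];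
  exists (mkposreal _ Hd0); intros s Hs;
  apply Rle_lt_trans with (2 := Hd s Hs).
  - apply (Rabs_fst_le (f s - f t)).
  - apply (Rabs_snd_le (f s - f t)).
Qed.

Definition ccontC (F : C -> C) (z : C) : Prop :=
  forall eps, 0 < eps -> exists d, 0 < d /\
    forall w, Cmod (w - z) < d -> Cmod (F w - F z) < eps.

Lemma Cmod_minus_le (x y : C) : Cmod (x - y) <= Cmod x + Cmod y.
Proof. unfold Cminus. rewrite <- (Cmod_opp y). apply Cmod_triangle. Qed.

Lemma cderiv_ccontC (F : C -> C) (z l : C) : cderiv F z l -> ccontC F z.
Proof.
  intros H eps Heps. destruct (H 1 Rlt_0_1) as [d [Hd0 Hd]].
  set (K := 1 + Cmod l).
  assert (HK : 0 < K) by (generalize (Cmod_ge_0 l); unfold K; lra).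
  exists (Rmin d (eps / K)). split.
  - apply Rmin_pos; [assumption|]. apply Rdiv_lt_0_compat; assumption.
  - intros w Hw.
    assert (H1 := Rlt_le_trans _ _ _ Hw (Rmin_l _ _)).
    assert (H2 := Rlt_le_trans _ _ _ Hw (Rmin_r _ _)).
    apply Hd in H1.
    replace (F w - F z)%C with ((F w - F z - l * (w - z)) + l * (w - z))%C by ring.
    apply Rle_lt_trans with (1 := Cmod_triangle _ _). rewrite Cmod_mult.
    apply Rle_lt_trans with (K * Cmod (w - z)). unfold K; lra.
    apply Rmult_lt_reg_l with (/ K). now apply Rinv_0_lt_compat.
    replace (/ K * (K * Cmod (w - z))) with (Cmod (w - z)) by (field; lra).
    unfold Rdiv in H2; lra.
Qed.

Lemma ccont_comp (F : C -> C) (p : R -> C) (t : R) :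
  (forall s, Cmod (p s - p t) <= Rabs (s - t)) -> ccontC F (p t) ->
  ccont (fun s => F (p s)) t.
Proof.
  intros Hp HF eps Heps. destruct (HF eps Heps) as [d [Hd0 Hd]].
  exists d; split; [assumption|]. intros s Hs. apply Hd.
  apply Rle_lt_trans with (1 := Hp s) (2 := Hs).
Qed.

Lemma ccont_horizontal (F : C -> C) (x y : R) :
  ccontC F (x, y) -> ccont (fun t => F (t, y)) x.
Proof.
  apply (ccont_comp F (fun t => (t, y))). intros s.
  apply Rle_trans with (1 := Cmod_le_Rabs _). simpl.
  replace (y + - y) with 0 by ring. rewrite Rabs_R0. unfold Rminus. lra.
Qed.

Lemma ccont_vertical (F : C -> C) (x y : R) :
  ccontC F (x, y) -> ccont (fun t => F (x, t)) y.
Proof.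
  apply (ccont_comp F (fun t => (x, t))). intros s.
  apply Rle_trans with (1 := Cmod_le_Rabs _). simpl.
  replace (x + - x) with 0 by ring. rewrite Rabs_R0. unfold Rminus. lra.
Qed.

(** The integral of [F] along the boundary of [[a,b] x [c,d]], opposite sides being paired:
    for affine [F] the paired integrands are constant and the two terms cancel. *)
Definition rect_int (F : C -> C) (a b c d : R) : C :=
  (CInt (fun t => F (t, c) - F (t, d)) a b
   + Ci * CInt (fun t => F (b, t) - F (a, t)) c d)%C.

Definition in_rect (a b c d : R) (z : C) : Prop :=
  a <= fst z <= b /\ c <= snd z <= d.

Definition rect_cont (F : C -> C) (a b c d : R) : Prop :=
  forall z, in_rect a b c d z -> ccontC F z.

(** Each side is cut by Chasles' relation, and the integrals along the inner sides cancel. *)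
Lemma rect_int_split (F : C -> C) (a m b c n d : R) :
  a <= m <= b -> c <= n <= d -> rect_cont F a b c d ->
  rect_int F a b c d =
  (rect_int F a m c n + rect_int F m b c n + rect_int F a m n d + rect_int F m b n d)%C.
Proof.
  intros Hm Hn HF.
  assert (Hh : forall p q y, a <= p -> p <= q -> q <= b -> c <= y <= d ->
                 ex_CInt (fun t => F (t, y)) p q).
  { intros p q y H1 H2 H3 H4. apply ex_CInt_ccont; [assumption|].
    intros t Ht. apply ccont_horizontal, HF. split; simpl; lra. }
  assert (Hv : forall p q x, c <= p -> p <= q -> q <= d -> a <= x <= b ->
                 ex_CInt (fun t => F (x, t)) p q).
  { intros p q x H1 H2 H3 H4. apply ex_CInt_ccont; [assumption|].
    intros t Ht. apply ccont_vertical, HF. split; simpl; lra. }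
  unfold rect_int.
  assert (Dh : forall p q y y', a <= p -> p <= q -> q <= b -> c <= y <= d -> c <= y' <= d ->
    CInt (fun t => F (t, y) - F (t, y'))%C p q
    = (CInt (fun t => F (t, y)) p q - CInt (fun t => F (t, y')) p q)%C).
  { intros. apply CInt_minus; apply Hh; assumption. }
  assert (Dv : forall p q x x', c <= p -> p <= q -> q <= d -> a <= x <= b -> a <= x' <= b ->
    CInt (fun t => F (x, t) - F (x', t))%C p q
    = (CInt (fun t => F (x, t)) p q - CInt (fun t => F (x', t)) p q)%C).
  { intros. apply CInt_minus; apply Hv; assumption. }
  assert (Ch : forall y, c <= y <= d ->
    CInt (fun t => F (t, y)) a b = (CInt (fun t => F (t, y)) a m + CInt (fun t => F (t, y)) m b)%C).
  { intros. apply CInt_Chasles; apply Hh; lra. }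
  assert (Cv : forall x, a <= x <= b ->
    CInt (fun t => F (x, t)) c d = (CInt (fun t => F (x, t)) c n + CInt (fun t => F (x, t)) n d)%C).
  { intros. apply CInt_Chasles; apply Hv; lra. }
  rewrite !Dh, !Dv by lra. rewrite !Ch, !Cv by lra.
  ring.
Qed.

(** Each paired integrand is a difference of two values of [F], each within [e * r] of the affine
    approximation; hence the factor 2. *)
Lemma rect_int_local (F : C -> C) (a b c d : R) (p l : C) (e r : R) :
  a <= b -> c <= d -> 0 <= e -> rect_cont F a b c d ->
  (forall z, in_rect a b c d z -> Cmod (F z - F p - l * (z - p)) <= e * r) ->
  Cmod (rect_int F a b c d) <= ((b - a) + (d - c)) * (2 * e * r).
Proof.
  intros Hab Hcd He HF Hl.
  assert (Hh : forall y, c <= y <= d -> ex_CInt (fun t => F (t, y)) a b).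
  { intros y H4. apply ex_CInt_ccont; [assumption|].
    intros t Ht. apply ccont_horizontal, HF. split; simpl; lra. }
  assert (Hv : forall x, a <= x <= b -> ex_CInt (fun t => F (x, t)) c d).
  { intros x H4. apply ex_CInt_ccont; [assumption|].
    intros t Ht. apply ccont_vertical, HF. split; simpl; lra. }
  assert (E1 := ex_CInt_minus _ _ _ _ (Hh c (conj (Rle_refl _) Hcd)) (Hh d (conj Hcd (Rle_refl _)))).
  assert (E2 := ex_CInt_minus _ _ _ _ (Hv b (conj Hab (Rle_refl _))) (Hv a (conj (Rle_refl _) Hab))).
  assert (K1 := ex_CInt_const (l * (Ci * RtoC (c - d)))%C a b).
  assert (K2 := ex_CInt_const (l * RtoC (b - a))%C c d).
  (* The two subtracted constants are the variations of the affine part between opposite sides.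
     Their integrals contribute [l * Ci * (c - d) * (b - a)] and [Ci * l * (b - a) * (d - c)], of
     sum zero. *)
  assert (T : rect_int F a b c d =
    (CInt (fun t => (F (t, c) - F (t, d)) - l * (Ci * RtoC (c - d)))%C a b
     + Ci * CInt (fun t => (F (b, t) - F (a, t)) - l * RtoC (b - a))%C c d)%C).
  { rewrite (CInt_minus _ _ _ _ E1 K1), (CInt_minus _ _ _ _ E2 K2), !CInt_const.
    unfold rect_int. rewrite !RtoC_minus. ring. }
  rewrite T, Rmult_plus_distr_r.
  assert (D : forall z w, in_rect a b c d z -> in_rect a b c d w ->
     Cmod (F z - F w - l * (z - w)) <= 2 * e * r).
  { intros z w Hz Hw.
    replace (F z - F w - l * (z - w))%C
      with ((F z - F p - l * (z - p)) - (F w - F p - l * (w - p)))%C by ring.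
    apply Rle_trans with (1 := Cmod_minus_le _ _).
    generalize (Hl z Hz) (Hl w Hw). lra. }
  apply Rle_trans with (1 := Cmod_triangle _ _).
  apply Rplus_le_compat.
  - apply Cmod_CInt_le; [assumption|now apply ex_CInt_minus|].
    intros t Ht.
    replace (Ci * RtoC (c - d))%C with ((t, c) - (t, d))%C
      by (apply injective_projections; simpl; ring).
    apply D; split; simpl; lra.
  - rewrite Cmod_mult, Cmod_Ci, Rmult_1_l.
    apply Cmod_CInt_le; [assumption|now apply ex_CInt_minus|].
    intros t Ht.
    replace (RtoC (b - a))%C with ((b, t) - (a, t))%C
      by (apply injective_projections; simpl; ring).
    apply D; split; simpl; lra.
Qed.

(** All rectangles have the proportions of the first one, so a corner [(x, y)] and a scale [s]
    determine each of them. The nested rectangles that inherit [P] shrink to the point [(u, v)]. *)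
Lemma rectangle_bisection (P : R -> R -> R -> Prop) (A B x0 y0 : R) :
  0 <= A -> 0 <= B ->
  (forall x y s, 0 < s -> P x y s -> exists x' y',
     x <= x' <= x + s / 2 * A /\ y <= y' <= y + s / 2 * B /\ P x' y' (s / 2)) ->
  P x0 y0 1 ->
  exists u v, (x0 <= u <= x0 + A /\ y0 <= v <= y0 + B) /\
    forall eps, 0 < eps -> exists x y s, 0 < s < eps /\
      x <= u <= x + s * A /\ y <= v <= y + s * B /\ P x y s.
Proof.
  intros HA HB Hstep H0.
  (* Packing the invariant with the data turns the bisection step into a function that can be
     iterated. *)
  pose (st := {p : R * R * R | 0 < snd p /\ P (fst (fst p)) (snd (fst p)) (snd p)}).
  assert (next : forall p : st, exists q : st,
     snd (proj1_sig q) = snd (proj1_sig p) / 2 /\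
     fst (fst (proj1_sig p)) <= fst (fst (proj1_sig q)) <= fst (fst (proj1_sig p)) + snd (proj1_sig p) / 2 * A /\
     snd (fst (proj1_sig p)) <= snd (fst (proj1_sig q)) <= snd (fst (proj1_sig p)) + snd (proj1_sig p) / 2 * B).
  { intros [[[x y] s] [Hs HP]]. simpl in *.
    destruct (Hstep x y s Hs HP) as [x' [y' [H1 [H2 H3]]]].
    assert (Hs2 : 0 < s / 2) by lra.
    exists (exist (fun p => 0 < snd p /\ P (fst (fst p)) (snd (fst p)) (snd p)) (x', y', s / 2) (conj Hs2 H3)).
    simpl. auto. }
  pose (nx := fun p => proj1_sig (constructive_indefinite_description _ (next p))).
  assert (Hnx := fun p => proj2_sig (constructive_indefinite_description _ (next p))).
  pose (p0 := exist (fun p => 0 < snd p /\ P (fst (fst p)) (snd (fst p)) (snd p)) (x0, y0, 1) (conj Rlt_0_1 H0) : st).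
  pose (q := fun n => Nat.iter n nx p0).
  pose (X := fun n => fst (fst (proj1_sig (q n)))).
  pose (Y := fun n => snd (fst (proj1_sig (q n)))).
  assert (Sq : forall n, snd (proj1_sig (q n)) = (/ 2) ^ n).
  { induction n; [reflexivity|].
    destruct (Hnx (q n)) as [E _]. change (snd (proj1_sig (nx (q n))) = (/ 2) ^ S n).
    unfold nx at 1. rewrite E, IHn. simpl. field. }
  assert (XS : forall n, X n <= X (S n) <= X n + (/ 2) ^ (S n) * A /\
                         Y n <= Y (S n) <= Y n + (/ 2) ^ (S n) * B).
  { intros n. destruct (Hnx (q n)) as [_ E].
    replace ((/ 2) ^ S n) with (snd (proj1_sig (q n)) / 2) by (rewrite Sq; simpl; field). exact E. }
  (* The left ends [Z n] increase, and by summing the geometric increments they stay below every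
     right end; their supremum lies in all the intervals. *)
  assert (lim : forall (Z : nat -> R) D, 0 <= D ->
     (forall n, Z n <= Z (S n) <= Z n + (/ 2) ^ (S n) * D) ->
     exists z, forall n, Z n <= z <= Z n + (/ 2) ^ n * D).
  { intros Z D HD HZ.
    assert (M : forall n m, Z n <= Z (n + m)%nat <= Z n + ((/ 2) ^ n - (/ 2) ^ (n + m)) * D).
    { intros n m. induction m.
      - rewrite Nat.add_0_r. lra.
      - rewrite Nat.add_succ_r. generalize (HZ (n + m)%nat).
        simpl (_ ^ S _). lra. }
    assert (Pp : forall n, 0 < (/ 2) ^ n) by (intros; apply pow_lt; lra).
    destruct (completeness (fun x => exists n, x = Z n)) as [z [Hz1 Hz2]].
    - exists (Z O + D). intros x [n ->]. generalize (M O n) (Pp n). simpl. nra.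
    - exists (Z O). now exists O.
    - exists z. intros n. split.
      + apply Hz1. now exists n.
      + apply Hz2. intros x [m ->].
        destruct (Nat.le_ge_cases m n) as [L|L].
        * replace n with (m + (n - m))%nat by lia.
          generalize (M m (n - m)%nat) (Pp (m + (n - m))%nat). nra.
        * replace m with (n + (m - n))%nat by lia.
          generalize (M n (m - n)%nat) (Pp (n + (m - n))%nat). nra. }
  destruct (lim X A HA (fun n => proj1 (XS n))) as [u Hu].
  destruct (lim Y B HB (fun n => proj2 (XS n))) as [v Hv].
  exists u, v. split.
  - generalize (Hu O) (Hv O). unfold X, Y; simpl. lra.
  - intros eps Heps.
    destruct (pow_lt_1_zero (/ 2)) with (y := eps) as [n Hn]; [rewrite Rabs_pos_eq; lra|assumption|].
    specialize (Hn n (Nat.le_refl n)).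
    assert (Pp : 0 < (/ 2) ^ n) by (apply pow_lt; lra).
    rewrite Rabs_pos_eq in Hn by lra.
    exists (X n), (Y n), ((/ 2) ^ n). repeat split; try lra; try apply Hu; try apply Hv.
    rewrite <- Sq. exact (proj2 (proj2_sig (q n))).
Qed.

Theorem goursat_rect (F : C -> C) (a b c d : R) :
  a <= b -> c <= d ->
  (forall z, in_rect a b c d z -> exists l, cderiv F z l) ->
  rect_int F a b c d = 0%C.
Proof.
  intros Hab Hcd HF.
  assert (HC : rect_cont F a b c d).
  { intros z Hz. destruct (HF z Hz) as [l Hl]. now apply cderiv_ccontC with l. }
  apply Cmod_eq_0. apply Rle_antisym; [|apply Cmod_ge_0].
  apply Rnot_lt_le. intros Hpos.
  set (K := Cmod (rect_int F a b c d)) in *.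
  set (A := b - a). set (B := d - c).
  (* Halving the scale divides [s ^ 2] by four, which is the share of the integral that at least one
     of the four quarters must keep. *)
  pose (P := fun x y s => (a <= x /\ x + s * A <= b /\ c <= y /\ y + s * B <= d) /\
     K * s ^ 2 <= Cmod (rect_int F x (x + s * A) y (y + s * B))).
  destruct (rectangle_bisection P A B a c) as [u [v [[Hu Hv] Huv]]].
  - unfold A; lra.
  - unfold B; lra.
  - intros x y s Hs [[X1 [X2 [Y1 Y2]]] HK].
    assert (HsA : 0 <= s / 2 * A) by (unfold A; nra).
    assert (HsB : 0 <= s / 2 * B) by (unfold B; nra).
    set (m := x + s / 2 * A). set (n := y + s / 2 * B).
    assert (Em : x + s * A = m + s / 2 * A) by (unfold m; field).
    assert (En : y + s * B = n + s / 2 * B) by (unfold n; field).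
    rewrite (rect_int_split F x m _ y n) in HK.
    2: unfold m in *; lra. 2: unfold n in *; lra.
    2: { intros z [Hz1 Hz2]. apply HC. split; lra. }
    apply NNPP. intros N.
    (* If no quarter qualified, the four strict bounds would add up to less than [K * s ^ 2]. *)
    assert (Q : forall x' y', (x' = x \/ x' = m) -> (y' = y \/ y' = n) ->
       Cmod (rect_int F x' (x' + s / 2 * A) y' (y' + s / 2 * B)) < K * (s / 2) ^ 2).
    { intros x' y' Hx' Hy'. apply Rnot_le_lt. intros L. apply N.
      exists x', y'.
      assert (x <= x' <= m /\ y <= y' <= n).
      { unfold m, n. destruct Hx' as [->| ->], Hy' as [->| ->]; unfold m, n; lra. }
      unfold m, n in *.
      repeat split; try lra; assumption. }
    assert (Q1 := Q x y (or_introl eq_refl) (or_introl eq_refl)).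
    assert (Q2 := Q m y (or_intror eq_refl) (or_introl eq_refl)).
    assert (Q3 := Q x n (or_introl eq_refl) (or_intror eq_refl)).
    assert (Q4 := Q m n (or_intror eq_refl) (or_intror eq_refl)).
    rewrite Em, En in HK. fold m in Q1, Q3. fold n in Q1, Q2.
    revert HK. apply Rlt_not_le.
    eapply Rle_lt_trans; [apply Cmod_triangle|].
    eapply Rle_lt_trans; [apply Rplus_le_compat_r; eapply Rle_trans; [apply Cmod_triangle|apply Rplus_le_compat_r, Cmod_triangle]|].
    lra.
  - unfold P, A, B. split; [lra|].
    replace (a + 1 * (b - a)) with b by ring.
    replace (c + 1 * (d - c)) with d by ring. fold K. lra.
  - destruct (HF (u, v)) as [l Hl]. { split; simpl; unfold A, B in *; lra. }
    set (S := A + B).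
    assert (HS : 0 <= S) by (unfold S, A, B; lra).
    assert (HS' : 0 < 4 * S ^ 2 + 1) by nra.
    (* The local estimate will give [K * s ^ 2 <= 2 * e * (s * S) ^ 2], that is
       [K <= 2 * e * S ^ 2], which this [e] contradicts; the [+ 1] covers a rectangle reduced to a
       point. *)
    set (e := K / (4 * S ^ 2 + 1)).
    assert (He : 0 < e) by (apply Rdiv_lt_0_compat; assumption).
    destruct (Hl e He) as [dl [Hd0 Hd]].
    assert (He' : 0 < dl / (S + 1)) by (apply Rdiv_lt_0_compat; lra).
    destruct (Huv _ He') as [x [y [s [Hs [Hx [Hy [[X1 [X2 [Y1 Y2]]] HK]]]]]]].
    assert (HsS : s * S < dl).
    { destruct Hs as [Hs1 Hs2]. apply Rmult_lt_compat_r with (r := S + 1) in Hs2; [|lra].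
      unfold Rdiv in Hs2. rewrite Rmult_assoc, Rinv_l in Hs2 by lra. nra. }
    assert (HsA : 0 <= s * A) by (unfold A; nra).
    assert (HsB : 0 <= s * B) by (unfold B; nra).
    assert (L := rect_int_local F x (x + s * A) y (y + s * B) (u, v) l e (s * S)).
    assert (L' : Cmod (rect_int F x (x + s * A) y (y + s * B)) <= s * S * (2 * e * (s * S))).
    { replace (s * S) with ((x + s * A - x) + (y + s * B - y)) at 1 by (unfold S; ring).
      apply L; try lra.
      - intros z [Hz1 Hz2]. apply HC. split; lra.
      - intros z [Hz1 Hz2].
        assert (D : Cmod (z - (u, v)) <= s * S).
        { apply Rle_trans with (1 := Cmod_le_Rabs _). simpl.
          unfold S. rewrite Rmult_plus_distr_l.
          apply Rplus_le_compat; apply Rabs_le; lra. }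
        apply Rle_trans with (e * Cmod (z - (u, v))).
        + apply Hd. lra.
        + apply Rmult_le_compat_l; lra. }
    assert (K <= 2 * e * S ^ 2).
    { assert (0 < s ^ 2) by (apply pow_lt; lra).
      apply Rmult_le_reg_r with (s ^ 2); [assumption|]. nra. }
    assert (EK : K = e * (4 * S ^ 2 + 1)) by (unfold e; field; lra).
    generalize (pow2_ge_0 S). nra.
Qed.

(** * Cauchy's formula for the derivative *)

Lemma derivable_pt_lim_iff (f : R -> R) (x l : R) :
  derivable_pt_lim f x l <->
  (forall eps, 0 < eps -> exists d, 0 < d /\
     forall h, Rabs h < d -> Rabs (f (x + h) - f x - l * h) <= eps * Rabs h).
Proof.
  split.
  - intros H eps Heps. destruct (H eps Heps) as [d Hd].
    exists d. split; [apply cond_pos|]. intros h Hh.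
    destruct (Req_dec h 0) as [->|Hn].
    + rewrite Rplus_0_r. replace (f x - f x - l * 0) with 0 by ring.
      rewrite Rabs_R0. lra.
    + specialize (Hd h Hn Hh).
      replace (f (x + h) - f x - l * h) with (((f (x + h) - f x) / h - l) * h) by (field; assumption).
      rewrite Rabs_mult. apply Rmult_le_compat_r; [apply Rabs_pos|lra].
  - intros H eps Heps. destruct (H (eps / 2)) as [d [Hd0 Hd]]; [lra|].
    exists (mkposreal d Hd0). intros h Hn Hh. simpl in Hh.
    specialize (Hd h Hh).
    replace ((f (x + h) - f x) / h - l) with ((f (x + h) - f x - l * h) * / h) by (field; assumption).
    rewrite Rabs_mult, Rabs_inv.
    assert (0 < Rabs h) by (now apply Rabs_pos_lt).
    apply Rmult_lt_reg_r with (Rabs h); [assumption|].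
    rewrite Rmult_assoc, Rinv_l by lra. nra.
Qed.

(** * The complex exponential and rules for complex derivatives *)

Definition cexp (w : C) : C := (exp (fst w) * cos (snd w), exp (fst w) * sin (snd w)).

Lemma cexp_plus (z w : C) : cexp (z + w) = (cexp z * cexp w)%C.
Proof.
  unfold cexp. apply injective_projections; simpl;
  rewrite exp_plus; [rewrite cos_plus|rewrite sin_plus]; ring.
Qed.

Lemma cexp_0 : cexp 0 = 1%C.
Proof.
  unfold cexp; simpl. rewrite exp_0, cos_0, sin_0.
  apply injective_projections; simpl; ring.
Qed.

Lemma cexp_opp_r (z : C) : (cexp z * cexp (- z) = 1)%C.
Proof. rewrite <- cexp_plus, <- cexp_0. f_equal. ring. Qed.

Lemma Cmod_cexp (z : C) : Cmod (cexp z) = exp (fst z).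
Proof.
  unfold Cmod, cexp; simpl.
  replace (_ + _) with (exp (fst z) ^ 2).
  - apply sqrt_pow2. apply Rlt_le, exp_pos.
  - generalize (sin2_cos2 (snd z)). unfold Rsqr. simpl. nra.
Qed.

Lemma cderiv_cexp_0 : cderiv cexp 0 1.
Proof.
  intros eps Heps.
  (* The errors below add up to at most [9 * e * m]. The bound [e <= 1] keeps [1 + h + E] within 3,
     and [m < e] makes the product [(h + E) * k] negligible. *)
  set (e := Rmin 1 (eps / 12)).
  assert (He : 0 < e) by (apply Rmin_pos; lra).
  assert (He1 : e <= 1) by apply Rmin_l.
  assert (He2 : e <= eps / 12) by apply Rmin_r.
  clearbody e.
  destruct (proj1 (derivable_pt_lim_iff _ _ _) (derivable_pt_lim_exp 0) e He) as [d1 [Hd1 H1]].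
  destruct (proj1 (derivable_pt_lim_iff _ _ _) (derivable_pt_lim_cos 0) e He) as [d2 [Hd2 H2]].
  destruct (proj1 (derivable_pt_lim_iff _ _ _) (derivable_pt_lim_sin 0) e He) as [d3 [Hd3 H3]].
  exists (Rmin (Rmin d1 d2) (Rmin d3 e)). split.
  { repeat apply Rmin_pos; assumption. }
  intros w Hw.
  replace (w - 0)%C with w in * by ring.
  assert (Hm : Cmod w < d1 /\ Cmod w < d2 /\ Cmod w < d3 /\ Cmod w < e).
  { generalize (Rmin_l (Rmin d1 d2) (Rmin d3 e)) (Rmin_r (Rmin d1 d2) (Rmin d3 e))
      (Rmin_l d1 d2) (Rmin_r d1 d2) (Rmin_l d3 e) (Rmin_r d3 e). lra. }
  destruct Hm as [M1 [M2 [M3 M4]]].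
  assert (A1 := Rabs_fst_le w). assert (A2 := Rabs_snd_le w).
  rewrite cexp_0.
  destruct w as [h k]. simpl in A1, A2.
  specialize (H1 h). specialize (H2 k). specialize (H3 k).
  rewrite Rplus_0_l, exp_0, Rmult_1_l in H1.
  rewrite Rplus_0_l, cos_0, sin_0, Ropp_0, Rmult_0_l in H2.
  rewrite Rplus_0_l, cos_0, sin_0, Rmult_1_l in H3.
  assert (H1' := H1 ltac:(lra)). assert (H2' := H2 ltac:(lra)). assert (H3' := H3 ltac:(lra)).
  set (m := Cmod (h, k)) in *.
  apply Rle_trans with (1 := Cmod_le_Rabs _). simpl.
  set (E := exp h - 1 - h) in *. set (Q := cos k - 1 - 0) in *. set (S := sin k - 0 - k) in *.
  replace (exp h * cos k + - (1) + - (1 * h - 0 * k)) with (E + (1 + h + E) * Q) by (unfold E, Q; ring).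
  replace (exp h * sin k + - 0 + - (1 * k + 0 * h)) with ((1 + h + E) * S + (h + E) * k) by (unfold E, S; ring).
  assert (Pm : 0 <= m) by apply Cmod_ge_0.
  assert (BE : Rabs E <= e * m) by (apply Rle_trans with (1 := H1'); apply Rmult_le_compat_l; lra).
  assert (BQ : Rabs Q <= e * m) by (apply Rle_trans with (1 := H2'); apply Rmult_le_compat_l; lra).
  assert (BS : Rabs S <= e * m) by (apply Rle_trans with (1 := H3'); apply Rmult_le_compat_l; lra).
  assert (Bem : e * m <= m) by nra.
  assert (BhE : Rabs (h + E) <= 2 * m) by (apply Rle_trans with (1 := Rabs_triang _ _); lra).
  assert (B3 : Rabs (1 + h + E) <= 3).
  { rewrite Rplus_assoc. apply Rle_trans with (1 := Rabs_triang _ _). rewrite Rabs_R1. lra. }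
  assert (T1 : Rabs (E + (1 + h + E) * Q) <= e * m + 3 * (e * m)).
  { apply Rle_trans with (1 := Rabs_triang _ _). rewrite Rabs_mult.
    apply Rplus_le_compat; [assumption|].
    apply Rmult_le_compat; try apply Rabs_pos; assumption. }
  assert (T2 : Rabs ((1 + h + E) * S + (h + E) * k) <= 3 * (e * m) + 2 * m * e).
  { apply Rle_trans with (1 := Rabs_triang _ _). rewrite !Rabs_mult.
    apply Rplus_le_compat; apply Rmult_le_compat; try apply Rabs_pos; lra. }
  nra.
Qed.

(** By [cexp_plus], the expansion at [w] is the one at [0] multiplied by [cexp w]. *)
Lemma cderiv_cexp (w : C) : cderiv cexp w (cexp w).
Proof.
  intros eps Heps.
  assert (P : 0 < Cmod (cexp w)) by (rewrite Cmod_cexp; apply exp_pos).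
  destruct (cderiv_cexp_0 (eps / Cmod (cexp w))) as [d [Hd0 Hd]].
  { apply Rdiv_lt_0_compat; assumption. }
  exists d. split; [assumption|]. intros z Hz.
  specialize (Hd (z - w)%C). replace (z - w - 0)%C with (z - w)%C in Hd by ring.
  specialize (Hd Hz). rewrite cexp_0 in Hd.
  replace (cexp z) with (cexp w * cexp (z - w))%C.
  2: { rewrite <- cexp_plus. f_equal. ring. }
  replace (cexp w * cexp (z - w) - cexp w - cexp w * (z - w))%C
    with (cexp w * (cexp (z - w) - 1 - 1 * (z - w)))%C by ring.
  rewrite Cmod_mult.
  apply Rmult_le_compat_l with (r := Cmod (cexp w)) in Hd; [|lra].
  apply Rle_trans with (1 := Hd). right. field. lra.
Qed.

(** The product rule, and the inner function in the chain rule, are stated for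
    [AbsRing_NormedModule C_AbsRing] instead of [C_NormedModule]. The differential estimate is the
    same in both; only linearity has to be given again. *)
Lemma is_derive_AbsRing_cderiv (f : C -> C) (z l : C) :
  @is_derive C_AbsRing (AbsRing_NormedModule C_AbsRing) f z l <-> cderiv f z l.
Proof.
  rewrite <- is_derive_cderiv. split; intros [_ H].
  - split; [apply (is_linear_scal_l (V:=C_NormedModule) l)|exact H].
  - split; [apply (is_linear_scal_l (V:=AbsRing_NormedModule C_AbsRing) l)|exact H].
Qed.

Lemma cderiv_const (c z : C) : cderiv (fun _ => c) z 0.
Proof. apply is_derive_cderiv. apply @is_derive_const. Qed.

Lemma cderiv_minus (f g : C -> C) (z l m : C) :
  cderiv f z l -> cderiv g z m -> cderiv (fun w => f w - g w)%C z (l - m)%C.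
Proof.
  intros Hf Hg. apply is_derive_cderiv.
  apply (@is_derive_minus C_AbsRing C_NormedModule); now apply is_derive_cderiv.
Qed.

Lemma cderiv_mult (f g : C -> C) (z l m : C) :
  cderiv f z l -> cderiv g z m -> cderiv (fun w => f w * g w)%C z (l * g z + f z * m)%C.
Proof.
  intros Hf Hg. apply is_derive_AbsRing_cderiv in Hf, Hg. apply is_derive_AbsRing_cderiv.
  exact (@is_derive_mult C_AbsRing f g z l m Hf Hg Cmult_comm).
Qed.

Lemma cderiv_comp (f g : C -> C) (z l m : C) :
  cderiv f (g z) l -> cderiv g z m -> cderiv (fun w => f (g w)) z (m * l)%C.
Proof.
  intros Hf Hg. apply is_derive_cderiv.
  apply (@is_derive_comp C_AbsRing C_NormedModule f g z l m).
  - now apply is_derive_cderiv.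
  - now apply is_derive_AbsRing_cderiv.
Qed.

Lemma cderiv_translate (a z l : C) (f : C -> C) :
  cderiv f z l -> cderiv (fun w => a + f w)%C z l.
Proof.
  intros H eps Heps. destruct (H eps Heps) as [d [Hd0 Hd]].
  exists d. split; [assumption|]. intros w Hw.
  replace (a + f w - (a + f z))%C with (f w - f z)%C by ring. now apply Hd.
Qed.

Lemma cderiv_scal (a z : C) : cderiv (fun w => a * w)%C z a.
Proof.
  intros eps Heps. exists 1. split; [lra|]. intros w _.
  replace (a * w - a * z - a * (w - z))%C with (RtoC 0) by ring.
  rewrite Cmod_0. apply Rmult_le_pos; [lra|apply Cmod_ge_0].
Qed.

Lemma cderiv_opp (z : C) : cderiv (fun w => - w)%C z (- (1))%C.
Proof.
  intros eps Heps. exists 1. split; [lra|]. intros w _.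
  replace (- w - - z - - (1) * (w - z))%C with (RtoC 0) by ring.
  rewrite Cmod_0. apply Rmult_le_pos; [lra|apply Cmod_ge_0].
Qed.

(** * Integrals over circles *)

Definition cis (t : R) : C := (cos t, sin t).

Lemma Cmod_cis (t : R) : Cmod (cis t) = 1.
Proof.
  unfold Cmod, cis; simpl. replace (_ + _) with 1; [apply sqrt_1|].
  generalize (sin2_cos2 t). unfold Rsqr. lra.
Qed.

Lemma cexp_polar (r t : R) : 0 < r -> cexp (ln r, t) = (RtoC r * cis t)%C.
Proof.
  intros Hr. unfold cexp, cis; simpl. rewrite exp_ln by assumption.
  apply injective_projections; simpl; ring.
Qed.

Lemma cis_opp_r (t : R) : (cis t * cis (- t) = 1)%C.
Proof.
  assert (H := cexp_opp_r (0, t)). rewrite <- H. unfold cexp, cis; simpl.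
  rewrite Ropp_0, exp_0. apply injective_projections; simpl; ring.
Qed.

(** Multiplied by [Ci / r], this is the contour integral of [h w / (w - z)^2] over the circle of
    radius [r], Cauchy's integral for the derivative. *)
Definition circ_int (h : C -> C) (z : C) (r : R) : C :=
  CInt (fun t => h (z + RtoC r * cis t) * cis (- t))%C 0 (2 * PI).

Definition holo_disc (h : C -> C) (z : C) (rad : R) : Prop :=
  forall w, Cmod (w - z) < rad -> exists l, cderiv h w l.

Lemma Cmod_circle (z : C) (r t : R) : 0 < r -> Cmod (z + RtoC r * cis t - z) = r.
Proof.
  intros Hr. replace (z + RtoC r * cis t - z)%C with (RtoC r * cis t)%C by ring.
  rewrite Cmod_mult, Cmod_cis, Cmod_R, Rabs_pos_eq by lra. ring.
Qed.

Lemma circle_cont (h : C -> C) (z : C) (r : R) (t : R) :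
  ccontC h (z + RtoC r * cis t) -> ccont (fun s => h (z + RtoC r * cis s))%C t.
Proof.
  intros H eps Heps. destruct (H eps Heps) as [d [Hd0 Hd]].
  assert (Hc := continuity_cos t). assert (Hs := continuity_sin t).
  set (q := 1 + Rabs r).
  assert (Hq : 0 < q) by (unfold q; generalize (Rabs_pos r); lra).
  assert (He : 0 < d / (2 * q)) by (apply Rdiv_lt_0_compat; lra).
  apply continuity_pt_locally with (eps := mkposreal _ He) in Hc.
  apply continuity_pt_locally with (eps := mkposreal _ He) in Hs.
  destruct (filter_and _ _ Hc Hs) as [e Hcs].
  exists e. split; [apply cond_pos|]. intros s Hse. apply Hd.
  destruct (Hcs s Hse) as [K1 K2]. simpl in K1, K2.
  replace (z + RtoC r * cis s - (z + RtoC r * cis t))%C with (RtoC r * (cis s - cis t))%C by ring.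
  rewrite Cmod_mult, Cmod_R.
  assert (B : Cmod (cis s - cis t) < d / q).
  { apply Rle_lt_trans with (1 := Cmod_le_Rabs _). simpl.
    replace (d / q) with (d / (2 * q) + d / (2 * q)) by (field; lra).
    apply Rplus_lt_compat; assumption. }
  apply Rle_lt_trans with (q * Cmod (cis s - cis t)).
  - apply Rmult_le_compat_r; [apply Cmod_ge_0|unfold q; lra].
  - apply Rmult_lt_compat_l with (r := q) in B; [|assumption].
    replace (q * (d / q)) with d in B by (field; lra). exact B.
Qed.

Lemma ccont_mult (f g : R -> C) (t : R) :
  ccont f t -> ccont g t -> ccont (fun s => f s * g s)%C t.
Proof.
  intros Hf Hg eps Heps.
  set (Mf := 1 + Cmod (f t)). set (Mg := 1 + Cmod (g t)).
  assert (0 < Mf) by (unfold Mf; generalize (Cmod_ge_0 (f t)); lra).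
  assert (0 < Mg) by (unfold Mg; generalize (Cmod_ge_0 (g t)); lra).
  destruct (Hf (Rmin 1 (eps / 2 / Mg))) as [d1 [Hd1 H1]].
  { apply Rmin_pos; [lra|apply Rdiv_lt_0_compat; lra]. }
  destruct (Hg (eps / 2 / Mf)) as [d2 [Hd2 H2]].
  { apply Rdiv_lt_0_compat; lra. }
  exists (Rmin d1 d2). split; [now apply Rmin_pos|]. intros s Hs.
  specialize (H1 s (Rlt_le_trans _ _ _ Hs (Rmin_l _ _))).
  specialize (H2 s (Rlt_le_trans _ _ _ Hs (Rmin_r _ _))).
  replace (f s * g s - f t * g t)%C with (f s * (g s - g t) + (f s - f t) * g t)%C by ring.
  apply Rle_lt_trans with (1 := Cmod_triangle _ _). rewrite !Cmod_mult.
  assert (B : Cmod (f s) <= Mf).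
  { replace (f s) with ((f s - f t) + f t)%C by ring.
    apply Rle_trans with (1 := Cmod_triangle _ _). unfold Mf.
    generalize (Rmin_l 1 (eps / 2 / Mg)). lra. }
  apply Rle_lt_trans with (Mf * Cmod (g s - g t) + Cmod (f s - f t) * Mg).
  { apply Rplus_le_compat.
    - apply Rmult_le_compat_r; [apply Cmod_ge_0|assumption].
    - apply Rmult_le_compat_l; [apply Cmod_ge_0|unfold Mg; lra]. }
  apply Rmult_lt_compat_l with (r := Mf) in H2; [|assumption].
  assert (H1' := Rlt_le_trans _ _ _ H1 (Rmin_r _ _)).
  apply Rmult_lt_compat_r with (r := Mg) in H1'; [|assumption].
  replace (Mf * (eps / 2 / Mf)) with (eps / 2) in H2 by (field; lra).
  replace (eps / 2 / Mg * Mg) with (eps / 2) in H1' by (field; lra).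
  lra.
Qed.

Lemma ccont_cis_opp (t : R) : ccont (fun s => cis (- s)) t.
Proof.
  intros eps Heps.
  destruct (circle_cont (fun w => w) 0 1 (- t)) with (eps := eps) as [d [Hd0 Hd]].
  - intros e He. exists e. split; [assumption|]. intros w Hw. exact Hw.
  - assumption.
  - exists d. split; [assumption|]. intros s Hs. specialize (Hd (- s)).
    replace (0 + RtoC 1 * cis (- s) - (0 + RtoC 1 * cis (- t)))%C
      with (cis (- s) - cis (- t))%C in Hd by ring.
    apply Hd. replace (- s - - t) with (- (s - t)) by ring. now rewrite Rabs_Ropp.
Qed.

Lemma ex_circ_int (h : C -> C) (z : C) (r : R) :
  0 < r -> (forall w, Cmod (w - z) = r -> ccontC h w) ->
  ex_CInt (fun t => h (z + RtoC r * cis t) * cis (- t))%C 0 (2 * PI).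
Proof.
  intros Hr Hh. apply ex_CInt_ccont.
  - generalize PI_RGT_0. lra.
  - intros t _. apply (ccont_mult (fun s => h (z + RtoC r * cis s)%C) (fun s => cis (- s))).
    + apply circle_cont, Hh. now apply Cmod_circle.
    + apply ccont_cis_opp.
Qed.

Lemma holo_disc_cont (h : C -> C) (z w : C) (rad : R) :
  holo_disc h z rad -> Cmod (w - z) < rad -> ccontC h w.
Proof. intros H Hw. destruct (H w Hw) as [l Hl]. now apply cderiv_ccontC with l. Qed.

Lemma circ_int_radius (h : C -> C) (z : C) (rad r s : R) :
  holo_disc h z rad -> 0 < s <= r -> r < rad ->
  (circ_int h z s * / RtoC s = circ_int h z r * / RtoC r)%C.
Proof.
  intros Hh Hs Hr.
  (* With [zeta = z + cexp w], the form [F w dw] is [h zeta / (zeta - z)^2 d zeta]. The rectangle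
     [[ln s, ln r] x [0, 2 PI]] covers an annulus, so [zeta] never reaches the pole [z]. *)
  pose (F := fun w => (h (z + cexp w) * cexp (- w))%C).
  assert (Pi := PI_RGT_0).
  assert (Hls : ln s <= ln r).
  { destruct (proj2 Hs) as [L|L]; [left; now apply ln_increasing|right; now f_equal]. }
  assert (HF : forall w, in_rect (ln s) (ln r) 0 (2 * PI) w -> exists l, cderiv F w l).
  { intros w [Hw _].
    destruct (Hh (z + cexp w)%C) as [l Hl].
    { replace (z + cexp w - z)%C with (cexp w) by ring. rewrite Cmod_cexp.
      apply Rle_lt_trans with (2 := Hr). rewrite <- (exp_ln r) by lra.
      destruct (proj2 Hw) as [L|L]; [left; now apply exp_increasing|right; now f_equal]. }
    eexists. apply (cderiv_mult (fun w => h (z + cexp w)%C) (fun w => cexp (- w)%C)).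
    - eapply (cderiv_comp h (fun w => z + cexp w)%C); [exact Hl|].
      apply cderiv_translate, cderiv_cexp.
    - eapply (cderiv_comp cexp (fun w => - w)%C); [apply cderiv_cexp|apply cderiv_opp]. }
  assert (HP : forall q t, 0 < q -> F (ln q, t) = (/ RtoC q * (h (z + RtoC q * cis t) * cis (- t)))%C).
  { intros q t Hq. unfold F. rewrite cexp_polar by assumption.
    replace (cexp (- (ln q, t))) with (/ RtoC q * cis (- t))%C; [ring|].
    unfold cexp, cis; simpl. rewrite exp_Ropp, exp_ln, <- RtoC_inv by lra.
    apply injective_projections; simpl; ring. }
  assert (G := goursat_rect F (ln s) (ln r) 0 (2 * PI) Hls ltac:(lra) HF).
  assert (HI : forall q, 0 < q < rad ->
    ex_CInt (fun t => h (z + RtoC q * cis t) * cis (- t))%C 0 (2 * PI)).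
  { intros q Hq. apply ex_circ_int; [lra|]. intros w Hw.
    apply (holo_disc_cont h z w rad Hh). lra. }
  unfold rect_int in G.
  (* The horizontal sides have the same image because [F] has period [2 PI] in the imaginary
     direction; their paired integrand vanishes. *)
  rewrite (CInt_ext _ (fun _ => 0%C) (ln s) (ln r)) in G.
  2: assumption.
  2: { intros t _. unfold F, cexp; simpl.
       rewrite !cos_neg, !sin_neg, cos_2PI, sin_2PI, cos_0, sin_0, !Ropp_0. ring. }
  rewrite CInt_const, Cmult_0_r, Cplus_0_l in G.
  rewrite (CInt_ext _ (fun t => / RtoC r * (h (z + RtoC r * cis t) * cis (- t))
      - / RtoC s * (h (z + RtoC s * cis t) * cis (- t)))%C 0 (2 * PI)) in G.
  2: lra.
  2: { intros t _. now rewrite !HP by lra. }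
  rewrite CInt_minus in G by (apply ex_CInt_mult, HI; lra).
  rewrite !CInt_mult in G by (apply HI; lra).
  fold (circ_int h z r) in G. fold (circ_int h z s) in G.
  assert (G2 : (Ci * (Ci * (/ RtoC r * circ_int h z r - / RtoC s * circ_int h z s)) = 0)%C)
    by (rewrite G; ring).
  apply Ceq_minus.
  replace (Ci * (Ci * (/ RtoC r * circ_int h z r - / RtoC s * circ_int h z s)))%C
    with ((Ci * Ci) * (circ_int h z r * / RtoC r - circ_int h z s * / RtoC s))%C in G2 by ring.
  replace (Ci * Ci)%C with (- (1))%C in G2.
  2: { apply injective_projections; simpl; ring. }
  rewrite <- G2. ring.
Qed.

(** For a constant function neither [circ_int] nor its quotient by the radius depends on the radius.
    Comparing the radii [r] and [2 * r] leaves only the value 0. *)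
Lemma circ_int_const (c z : C) (r : R) : 0 < r -> circ_int (fun _ => c) z r = 0%C.
Proof.
  intros Hr.
  assert (H : holo_disc (fun _ => c) z (3 * r)).
  { intros w _. eexists. apply cderiv_const. }
  assert (E := circ_int_radius _ z (3 * r) (2 * r) r H ltac:(lra) ltac:(lra)).
  change (circ_int (fun _ => c) z (2 * r)) with (circ_int (fun _ => c) z r) in E.
  set (I := circ_int (fun _ => c) z r) in *.
  assert (Nr : RtoC r <> 0%C) by (intros K; apply RtoC_inj in K; lra).
  assert (N2 : RtoC 2 <> 0%C) by (intros K; apply RtoC_inj in K; lra).
  rewrite RtoC_mult in E.
  replace I with ((I * / RtoC r - I * / (RtoC 2 * RtoC r)) * (RtoC 2 * RtoC r))%C
    by (field; auto).
  rewrite <- E. ring.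
Qed.

(** As the radius tends to [0], the differentiability of [h] at [z] identifies the constant
    value of [circ_int h z r / r]. *)
Theorem cauchy_derivative (h : C -> C) (z l : C) (rad r : R) :
  holo_disc h z rad -> cderiv h z l -> 0 < r < rad ->
  circ_int h z r = (RtoC (2 * PI * r) * l)%C.
Proof.
  intros Hh Hl Hr.
  assert (Pi := PI_RGT_0).
  assert (Nr : RtoC r <> 0%C) by (intros K; apply RtoC_inj in K; lra).
  assert (HC : forall q, 0 < q < rad ->
    ex_CInt (fun t => h (z + RtoC q * cis t) * cis (- t))%C 0 (2 * PI)).
  { intros q Hq. apply ex_circ_int; [lra|]. intros w Hw.
    apply (holo_disc_cont h z w rad Hh). lra. }
  assert (D : (circ_int h z r * / RtoC r - RtoC (2 * PI) * l = 0)%C).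
  { apply Cmod_eq_0, Rle_antisym; [|apply Cmod_ge_0].
    apply le_epsilon. intros eps Heps. rewrite Rplus_0_l.
    destruct (Hl (eps / (2 * PI))) as [d [Hd0 Hd]].
    { apply Rdiv_lt_0_compat; lra. }
    (* [s <= r] permits the change of radius, and [d / 2] keeps the circle strictly inside the disc
       where the expansion of [h] holds. *)
    set (s := Rmin r (d / 2)).
    assert (Hs : 0 < s) by (apply Rmin_pos; lra).
    assert (Hsr : s <= r) by apply Rmin_l.
    assert (Hsd : s <= d / 2) by apply Rmin_r.
    assert (Ns : RtoC s <> 0%C) by (intros K; apply RtoC_inj in K; lra).
    rewrite <- (circ_int_radius h z rad r s Hh) by lra.
    (* Subtracting the vanishing integral of the constant [h z], and writing [2 PI l] as the
       integral of [l], leaves a single integral, that of the first-order remainder of [h] divided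
       by [s]. *)
    replace (circ_int h z s * / RtoC s - RtoC (2 * PI) * l)%C
      with (/ RtoC s * (circ_int h z s - circ_int (fun _ => h z) z s)
            - CInt (fun _ => l) 0 (2 * PI))%C.
    2: { rewrite circ_int_const, CInt_const, Rminus_0_r by assumption. ring. }
    assert (X1 := HC s ltac:(lra)).
    assert (X2 : ex_CInt (fun t => h z * cis (- t))%C 0 (2 * PI)).
    { apply (ex_circ_int (fun _ => h z) z s Hs). intros w _.
      apply cderiv_ccontC with (RtoC 0). apply cderiv_const. }
    unfold circ_int.
    rewrite <- (CInt_minus _ _ _ _ X1 X2).
    assert (X3 := ex_CInt_minus _ _ _ _ X1 X2).
    rewrite <- (CInt_mult _ _ _ _ X3).
    assert (X4 := ex_CInt_mult (/ RtoC s) _ _ _ X3).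
    rewrite <- (CInt_minus _ _ _ _ X4 (ex_CInt_const l _ _)).
    replace eps with ((2 * PI - 0) * (eps / (2 * PI))) by (field; lra).
    apply Cmod_CInt_le; [lra|apply ex_CInt_minus; [exact X4|apply ex_CInt_const]|].
    intros t _.
    specialize (Hd (z + RtoC s * cis t)%C). rewrite Cmod_circle in Hd by assumption.
    specialize (Hd ltac:(lra)).
    replace (/ RtoC s * (h (z + RtoC s * cis t) * cis (- t) - h z * cis (- t)) - l)%C
      with (/ RtoC s * cis (- t) * (h (z + RtoC s * cis t) - h z - l * (z + RtoC s * cis t - z)))%C.
    2: { transitivity (/ RtoC s * (h (z + RtoC s * cis t) * cis (- t) - h z * cis (- t))
           - (/ RtoC s * RtoC s) * (cis t * cis (- t)) * l)%C; [ring|].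
         rewrite cis_opp_r, Cinv_l by assumption. ring. }
    rewrite !Cmod_mult, Cmod_cis, Cmod_inv, Cmod_R, Rabs_pos_eq by (assumption || lra).
    apply Rmult_le_reg_l with s; [assumption|].
    rewrite Rmult_1_r, <- Rmult_assoc, Rinv_r by lra. lra. }
  apply Ceq_minus in D.
  rewrite !RtoC_mult in *.
  replace (circ_int h z r) with (circ_int h z r * / RtoC r * RtoC r)%C by (field; assumption).
  rewrite D. ring.
Qed.

Lemma circ_int_bound (h : C -> C) (z : C) (r M : R) :
  0 < r -> (forall w, Cmod (w - z) = r -> ccontC h w) ->
  (forall w, Cmod (w - z) = r -> Cmod (h w) <= M) ->
  Cmod (circ_int h z r) <= 2 * PI * M.
Proof.
  intros Hr Hc HM. assert (Pi := PI_RGT_0).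
  replace (2 * PI * M) with ((2 * PI - 0) * M) by ring.
  apply Cmod_CInt_le; [lra|now apply ex_circ_int|].
  intros t _. rewrite Cmod_mult, Cmod_cis, Rmult_1_r. apply HM. now apply Cmod_circle.
Qed.

(** The bound on [h] is available in the open disc only, so the circle of radius [rad / 2] is used;
    hence the factor 2. *)
Lemma cauchy_estimate (h : C -> C) (z l : C) (rad M : R) :
  0 < rad -> holo_disc h z rad -> cderiv h z l ->
  (forall w, Cmod (w - z) < rad -> Cmod (h w) <= M) ->
  Cmod l <= 2 / rad * M.
Proof.
  intros Hrad Hh Hl HM. assert (Pi := PI_RGT_0).
  assert (E := cauchy_derivative h z l rad (rad / 2) Hh Hl ltac:(lra)).
  assert (B := circ_int_bound h z (rad / 2) M ltac:(lra)).
  rewrite E, Cmod_mult, Cmod_R, Rabs_pos_eq in B by nra.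
  assert (B' : 2 * PI * (rad / 2) * Cmod l <= 2 * PI * M).
  { apply B; intros w Hw; [apply (holo_disc_cont h z w rad Hh)|apply HM]; lra. }
  apply Rmult_le_reg_l with (2 * PI * (rad / 2)); [nra|].
  apply Rle_trans with (1 := B'). right. field. lra.
Qed.

(** * Higher derivatives *)

Lemma cderiv_C_derive (f : C -> C) (z : C) :
  (exists l, cderiv f z l) -> cderiv f z (C_derive f z).
Proof.
  intros [l Hl]. apply is_derive_cderiv in Hl.
  rewrite (is_C_derive_unique f z l Hl). now apply is_derive_cderiv.
Qed.

(** * Mean value inequalities along segments *)

Lemma derivable_fst_along (g : C -> C) (z v l : C) (t : R) :
  cderiv g (z + RtoC t * v) l ->
  derivable_pt_lim (fun s => fst (g (z + RtoC s * v)%C)) t (fst (l * v)%C).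
Proof.
  intros H. apply derivable_pt_lim_iff. intros eps Heps.
  assert (Hv := Cmod_ge_0 v).
  destruct (H (eps / (Cmod v + 1))) as [d [Hd0 Hd]].
  { apply Rdiv_lt_0_compat; lra. }
  exists (d / (Cmod v + 1)). split; [apply Rdiv_lt_0_compat; lra|].
  intros s Hs.
  specialize (Hd (z + RtoC (t + s) * v)%C).
  assert (E : (z + RtoC (t + s) * v - (z + RtoC t * v) = RtoC s * v)%C)
    by (rewrite RtoC_plus; ring).
  rewrite E, Cmod_mult, Cmod_R in Hd.
  assert (Ps := Rabs_pos s).
  assert (Hd' : Cmod (g (z + RtoC (t + s) * v) - g (z + RtoC t * v) - l * (RtoC s * v))%C
     <= eps / (Cmod v + 1) * (Rabs s * Cmod v)).
  { apply Hd. apply Rmult_lt_compat_r with (r := Cmod v + 1) in Hs; [|lra].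
    unfold Rdiv in Hs. rewrite Rmult_assoc, Rinv_l in Hs by lra. nra. }
  apply Rle_trans with (eps / (Cmod v + 1) * (Rabs s * Cmod v)).
  - apply Rle_trans with (2 := Hd'). apply Rle_trans with (2 := Rabs_fst_le _).
    right. f_equal. simpl. ring.
  - apply Rle_trans with (eps / (Cmod v + 1) * (Rabs s * (Cmod v + 1))).
    + apply Rmult_le_compat_l; [left; apply Rdiv_lt_0_compat; lra|nra].
    + right. field. lra.
Qed.

Lemma fst_increment_le (g g' : C -> C) (z w : C) (K : R) :
  (forall t, 0 <= t <= 1 -> cderiv g (z + RtoC t * (w - z))%C (g' (z + RtoC t * (w - z))%C) /\
     Cmod (g' (z + RtoC t * (w - z))%C) <= K) ->
  Rabs (fst (g w - g z)%C) <= K * Cmod (w - z).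
Proof.
  intros H.
  destruct (MVT_cor2 (fun s => fst (g (z + RtoC s * (w - z))%C))
     (fun s => fst (g' (z + RtoC s * (w - z)) * (w - z))%C) 0 1 Rlt_0_1) as [c [E Hc]].
  - intros c Hc. apply derivable_fst_along, H, Hc.
  - replace (fst (g w - g z)%C) with (fst (g' (z + RtoC c * (w - z)) * (w - z))%C).
    + apply Rle_trans with (1 := Rabs_fst_le _). rewrite Cmod_mult.
      apply Rmult_le_compat_r; [apply Cmod_ge_0|]. apply H. lra.
    + rewrite Rminus_0_r, Rmult_1_r in E. rewrite <- E.
      replace (z + RtoC 1 * (w - z))%C with w by ring.
      replace (z + RtoC 0 * (w - z))%C with z by ring. reflexivity.
Qed.

(** The mean value theorem holds for real functions only. It is applied to the real parts of [g] and
    of [- Ci * g], the latter being the imaginary part of [g]; adding the two bounds costs the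
    factor 2. *)
Lemma mean_value_C (g g' : C -> C) (z w : C) (K : R) :
  (forall t, 0 <= t <= 1 -> cderiv g (z + RtoC t * (w - z))%C (g' (z + RtoC t * (w - z))%C) /\
     Cmod (g' (z + RtoC t * (w - z))%C) <= K) ->
  Cmod (g w - g z) <= 2 * K * Cmod (w - z).
Proof.
  intros H.
  assert (H1 := fst_increment_le g g' z w K H).
  assert (H2 := fst_increment_le (fun u => - Ci * g u)%C (fun u => - Ci * g' u)%C z w K).
  apply Rle_trans with (1 := Cmod_le_Rabs _).
  replace (2 * K * Cmod (w - z)) with (K * Cmod (w - z) + K * Cmod (w - z)) by ring.
  apply Rplus_le_compat; [exact H1|].
  replace (snd (g w - g z)%C) with (fst (- Ci * g w - - Ci * g z)%C) by (simpl; ring).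
  apply H2. intros t Ht. destruct (H t Ht) as [D B]. split.
  - assert (M := cderiv_mult (fun _ => - Ci)%C g _ _ _ (cderiv_const (- Ci)%C _) D).
    simpl in M.
    replace (- Ci * g' (z + RtoC t * (w - z)))%C
      with (0 * g (z + RtoC t * (w - z)) + - Ci * g' (z + RtoC t * (w - z)))%C by ring.
    exact M.
  - rewrite Cmod_mult, Cmod_opp, Cmod_Ci, Rmult_1_l. exact B.
Qed.

Lemma Cmod_segment (z v w : C) (t : R) :
  0 <= t <= 1 -> Cmod (z + RtoC t * (w - z) - v) <= Rmax (Cmod (z - v)) (Cmod (w - v)).
Proof.
  intros Ht.
  replace (z + RtoC t * (w - z) - v)%C
    with (RtoC (1 - t) * (z - v) + RtoC t * (w - v))%C by (rewrite RtoC_minus; ring).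
  apply Rle_trans with (1 := Cmod_triangle _ _).
  rewrite !Cmod_mult, !Cmod_R, !Rabs_pos_eq by lra.
  generalize (Rmax_l (Cmod (z - v)) (Cmod (w - v))) (Rmax_r (Cmod (z - v)) (Cmod (w - v))). nra.
Qed.

(** The mean value inequality for [g u - g' z * u], whose derivative is [g' u - g' z]. *)
Lemma taylor2_C (g g' : C -> C) (z w : C) (K : R) :
  (forall t, 0 <= t <= 1 -> cderiv g (z + RtoC t * (w - z))%C (g' (z + RtoC t * (w - z))%C) /\
     Cmod (g' (z + RtoC t * (w - z))%C - g' z) <= K) ->
  Cmod (g w - g z - g' z * (w - z)) <= 2 * K * Cmod (w - z).
Proof.
  intros H.
  replace (g w - g z - g' z * (w - z))%C with
    ((g w - g' z * w) - (g z - g' z * z))%C by ring.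
  apply (mean_value_C (fun u => g u - g' z * u)%C (fun u => g' u - g' z)%C).
  intros t Ht. destruct (H t Ht) as [D B]. split; [|exact B].
  exact (cderiv_minus g (fun u => g' z * u)%C _ _ _ D (cderiv_scal _ _)).
Qed.

(** The operator [h |-> circ_int h z r / (2 pi r)], which computes derivatives, applied to the
    difference quotients of [h] gives the difference quotients of [h']. *)
Lemma derivative_differentiable (h h' : C -> C) (z0 : C) (rad : R) :
  0 < rad -> (forall w, Cmod (w - z0) < rad -> cderiv h w (h' w)) ->
  exists l, cderiv h' z0 l.
Proof.
  intros Hrad0 Hh0. assert (Pi := PI_RGT_0).
  (* The factor 8 leaves room for the nested radii below: [h'] is bounded up to [4 * r], and its
     increments are controlled from points up to [2 * r] with displacements up to [r]. *)
  assert (Bd : exists r M, 0 < r /\ 0 <= M /\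
    (forall w, Cmod (w - z0) < 8 * r -> cderiv h w (h' w) /\ Cmod (h w) <= M)).
  { destruct (cderiv_ccontC h z0 (h' z0)) with (eps := 1) as [d [Hd0 Hd]].
    - apply Hh0. replace (z0 - z0)%C with (RtoC 0) by ring. now rewrite Cmod_0.
    - lra.
    - exists (Rmin (rad / 8) (d / 8)), (1 + Cmod (h z0)).
      generalize (Rmin_l (rad / 8) (d / 8)) (Rmin_r (rad / 8) (d / 8)). intros R1 R2.
      split; [apply Rmin_pos; lra|split; [generalize (Cmod_ge_0 (h z0)); lra|]].
      intros w Hw. split; [apply Hh0; lra|].
      replace (h w) with ((h w - h z0) + h z0)%C by ring.
      apply Rle_trans with (1 := Cmod_triangle _ _). specialize (Hd w ltac:(lra)). lra. }
  clear rad Hrad0 Hh0. destruct Bd as [r [M [Hr [HM Hb]]]].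
  assert (Tri : forall u v w, Cmod (u - w) <= Cmod (u - v) + Cmod (v - w)).
  { intros u v w. replace (u - w)%C with ((u - v) + (v - w))%C by ring. apply Cmod_triangle. }
  assert (Hd : forall z q, Cmod (z - z0) + q <= 8 * r -> holo_disc h z q).
  { intros z q Hq w Hw. exists (h' w). apply Hb. generalize (Tri w z z0). lra. }
  set (K1 := M / r).
  assert (HK1 : 0 <= K1) by (apply Rdiv_le_0_compat; lra).
  assert (B1 : forall w, Cmod (w - z0) <= 4 * r -> Cmod (h' w) <= K1).
  { intros w Hw.
    apply Rle_trans with (2 / (4 * r) * M).
    - apply (cauchy_estimate h w); [lra|apply Hd; lra|apply Hb; lra|].
      intros u Hu. apply Hb. generalize (Tri u w z0). lra.
    - replace (2 / (4 * r) * M) with (K1 / 2) by (unfold K1; field; lra). lra. }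
  assert (L1 : forall u w, Cmod (u - z0) <= 4 * r -> Cmod (w - z0) <= 4 * r ->
     Cmod (h w - h u) <= 2 * K1 * Cmod (w - u)).
  { intros u w Hu Hw. apply (mean_value_C h h'). intros t Ht.
    assert (S := Rle_trans _ _ _ (Cmod_segment u z0 w t Ht) (Rmax_lub _ _ _ Hu Hw)).
    split; [apply Hb; lra|apply B1; lra]. }
  set (K2 := 4 * K1 / r).
  assert (HK2 : 0 <= K2) by (apply Rdiv_le_0_compat; lra).
  (* [h'] is Lipschitz: Cauchy's estimate is applied to [q], the difference between a translate of
     [h] and [h], which [L1] bounds by [2 * K1 * Cmod (w - z)]. *)
  assert (L2 : forall z w, Cmod (z - z0) <= 2 * r -> Cmod (w - z) <= r ->
     Cmod (h' w - h' z) <= K2 * Cmod (w - z)).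
  { intros z w Hz Hw.
    set (q := fun u => (h (w - z + u) - h u)%C).
    assert (Hq : forall u, Cmod (u - z) < r -> cderiv q u (h' (w - z + u) - h' u)%C).
    { intros u Hu. apply cderiv_minus.
      - replace (h' (w - z + u))%C with (1 * h' (w - z + u))%C by ring.
        apply (cderiv_comp h (fun u => w - z + u)%C).
        + apply Hb. generalize (Cmod_triangle (w - z) (u - z0)) (Tri u z z0).
          replace (w - z + u - z0)%C with ((w - z) + (u - z0))%C by ring. lra.
        + apply (cderiv_translate (w - z) u 1 (fun u => u)).
          intros e He. exists 1. split; [lra|]. intros x _.
          replace (x - u - 1 * (x - u))%C with (RtoC 0) by ring. rewrite Cmod_0.
          apply Rmult_le_pos; [lra|apply Cmod_ge_0].
      - apply Hb. generalize (Tri u z z0). lra. }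
    replace (K2 * Cmod (w - z)) with (2 / r * (2 * K1 * Cmod (w - z)))
      by (unfold K2; field; lra).
    replace (h' w) with (h' (w - z + z)%C) by (f_equal; ring).
    apply (cauchy_estimate q z); [lra| |apply Hq|].
    - intros u Hu. exists (h' (w - z + u) - h' u)%C. now apply Hq.
    - replace (z - z)%C with (RtoC 0) by ring. rewrite Cmod_0. lra.
    - intros u Hu. unfold q.
      replace (w - z)%C with ((w - z + u) - u)%C at 2 by ring.
      assert (U := Tri u z z0).
      apply L1; [lra|].
      generalize (Cmod_triangle (w - z) (u - z0)).
      replace (w - z + u - z0)%C with ((w - z) + (u - z0))%C by ring. lra. }
  assert (L3 : forall z w, Cmod (z - z0) <= 2 * r -> Cmod (w - z) <= r ->
     Cmod (h w - h z - h' z * (w - z)) <= 2 * (K2 * Cmod (w - z)) * Cmod (w - z)).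
  { intros z w Hz Hw. apply taylor2_C. intros t Ht.
    assert (S : Cmod (z + RtoC t * (w - z) - z) <= Cmod (w - z)).
    { apply Rle_trans with (1 := Cmod_segment z z w t Ht).
      apply Rmax_lub; [|lra]. replace (z - z)%C with (RtoC 0) by ring.
      rewrite Cmod_0. apply Cmod_ge_0. }
    split.
    - apply Hb. generalize (Tri (z + RtoC t * (w - z))%C z z0). lra.
    - apply Rle_trans with (K2 * Cmod (z + RtoC t * (w - z) - z)).
      + apply L2; lra.
      + now apply Rmult_le_compat_l. }
  assert (Z0 : Cmod (z0 - z0) = 0).
  { replace (z0 - z0)%C with (RtoC 0) by ring. apply Cmod_0. }
  (* Integrating [h'] over the circle requires its continuity, which cannot be drawn from its
     differentiability, still to be proved; [L2] supplies it. *)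
  assert (Hc' : forall w, Cmod (w - z0) = r -> ccontC h' w).
  { intros w Hw e He. exists (Rmin r (e / (K2 + 1))).
    assert (0 < e / (K2 + 1)) by (apply Rdiv_lt_0_compat; lra).
    split; [apply Rmin_pos; lra|].
    intros u Hu. generalize (Rmin_l r (e / (K2 + 1))) (Rmin_r r (e / (K2 + 1))). intros R1 R2.
    apply Rle_lt_trans with (K2 * Cmod (u - w)); [apply L2; lra|].
    apply Rle_lt_trans with ((K2 + 1) * Cmod (u - w)).
    { generalize (Cmod_ge_0 (u - w)). nra. }
    replace e with ((K2 + 1) * (e / (K2 + 1))) by (field; lra).
    apply Rmult_lt_compat_l; lra. }
  assert (Hcr : forall z, Cmod (z - z0) <= r ->
     ex_CInt (fun t => h (z + RtoC r * cis t) * cis (- t))%C 0 (2 * PI)).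
  { intros z Hz. apply ex_circ_int; [lra|]. intros w Hw.
    apply (holo_disc_cont h z w (4 * r)); [apply Hd; lra|lra]. }
  assert (Hci := ex_circ_int h' z0 r Hr Hc').
  set (c := RtoC (2 * PI * r)).
  assert (Hc : c <> 0%C). { intros K. apply RtoC_inj in K. nra. }
  exists (/ c * circ_int h' z0 r)%C.
  intros e He.
  (* By [L3] the integral of the remainder is at most [2 * PI * 2 * K2 * m ^ 2]. Divided by
     [2 * PI * r], it is at most [e * m] once [2 * K2 * m <= e * r]. *)
  exists (Rmin r (e * r / (2 * K2 + 1))).
  assert (He' : 0 < e * r / (2 * K2 + 1)) by (apply Rdiv_lt_0_compat; [nra|lra]).
  split; [apply Rmin_pos; lra|].
  intros w Hw. generalize (Rmin_l r (e * r / (2 * K2 + 1))) (Rmin_r r (e * r / (2 * K2 + 1))).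
  intros R1 R2.
  assert (Ew : circ_int h w r = (c * h' w)%C).
  { apply (cauchy_derivative h w (h' w) (4 * r)); [apply Hd; lra|apply Hb; lra|lra]. }
  assert (E0 : circ_int h z0 r = (c * h' z0)%C).
  { apply (cauchy_derivative h z0 (h' z0) (4 * r)); [apply Hd; lra|apply Hb; lra|lra]. }
  replace (h' w - h' z0 - / c * circ_int h' z0 r * (w - z0))%C
    with (/ c * (circ_int h w r - circ_int h z0 r - (w - z0) * circ_int h' z0 r))%C.
  2: { rewrite Ew, E0. field. exact Hc. }
  assert (X1 := Hcr w ltac:(lra)). assert (X2 := Hcr z0 ltac:(lra)).
  unfold circ_int.
  rewrite <- (CInt_mult _ _ _ _ Hci).
  rewrite <- (CInt_minus _ _ _ _ X1 X2).
  assert (X3 := ex_CInt_minus _ _ _ _ X1 X2).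
  assert (X4 := ex_CInt_mult (w - z0)%C _ _ _ Hci).
  rewrite <- (CInt_minus _ _ _ _ X3 X4).
  assert (X5 := ex_CInt_minus _ _ _ _ X3 X4).
  set (m := Cmod (w - z0)) in *.
  assert (Hm : 0 <= m) by apply Cmod_ge_0.
  assert (Bi := Cmod_CInt_le _ 0 (2 * PI) (2 * (K2 * m) * m) ltac:(lra) X5).
  rewrite Cmod_mult, Cmod_inv by exact Hc.
  unfold c at 1. rewrite Cmod_R, Rabs_pos_eq by nra.
  apply Rmult_le_reg_l with (2 * PI * r); [nra|].
  rewrite <- Rmult_assoc, Rinv_r, Rmult_1_l by nra.
  apply Rle_trans with ((2 * PI - 0) * (2 * (K2 * m) * m)).
  - apply Bi. intros t _. cbv beta.
    replace (h (w + RtoC r * cis t) * cis (- t) - h (z0 + RtoC r * cis t) * cis (- t)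
       - (w - z0) * (h' (z0 + RtoC r * cis t) * cis (- t)))%C
    with ((h (w + RtoC r * cis t) - h (z0 + RtoC r * cis t)
       - h' (z0 + RtoC r * cis t) * ((w + RtoC r * cis t) - (z0 + RtoC r * cis t))) * cis (- t))%C by ring.
    rewrite Cmod_mult, Cmod_cis, Rmult_1_r.
    assert (Em : Cmod (w + RtoC r * cis t - (z0 + RtoC r * cis t)) = m).
    { unfold m. f_equal. ring. }
    rewrite <- Em. apply L3.
    + rewrite Cmod_circle by assumption. lra.
    + rewrite Em. lra.
  - assert (T : 2 * K2 * m <= e * r).
    { apply Rle_trans with ((2 * K2 + 1) * (e * r / (2 * K2 + 1))).
      - apply Rmult_le_compat; lra.
      - right. field. lra. }
    assert (T2 := Rmult_le_compat_r m _ _ Hm T).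
    apply Rmult_le_compat_l with (r := 2 * PI) in T2; [|lra]. lra.
Qed.

Definition iter_deriv (p : nat) (f : C -> C) : C -> C := Nat.iter p C_derive f.

(** [C_derive] is total, so the iterates exist everywhere. On an open set of holomorphy they are
    true derivatives, by induction with [derivative_differentiable]. *)
Lemma cderiv_iter_deriv (U : C -> Prop) (f : C -> C) :
  (forall z, U z -> exists d, 0 < d /\ forall w, Cmod (w - z) < d -> U w) ->
  (forall z, U z -> exists l, cderiv f z l) ->
  forall p z, U z -> cderiv (iter_deriv p f) z (iter_deriv (S p) f z).
Proof.
  intros HU Hf p. induction p; intros z Hz.
  - apply cderiv_C_derive, Hf, Hz.
  - apply cderiv_C_derive. destruct (HU z Hz) as [d [Hd0 Hd]].
    apply (derivative_differentiable (iter_deriv p f) _ z d Hd0).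
    intros w Hw. apply IHp, Hd, Hw.
Qed.

(** A tube described by its radius and without the infimum; [tube_nbh] relates the two forms. *)
Definition nbh (d : R) (z : C) : Prop := exists t, II t /\ Cmod (z - RtoC t) < d.

Lemma nbh_ball (d e : R) (z w : C) : nbh d z -> Cmod (w - z) < e -> nbh (d + e) w.
Proof.
  intros [t [Ht Hz]] Hw. exists t. split; [assumption|].
  replace (w - RtoC t)%C with ((z - RtoC t) + (w - z))%C by ring.
  apply Rle_lt_trans with (1 := Cmod_triangle _ _). lra.
Qed.

Lemma nbh_open (d : R) (z : C) :
  nbh d z -> exists e, 0 < e /\ forall w, Cmod (w - z) < e -> nbh d w.
Proof.
  intros [t [Ht Hz]]. exists (d - Cmod (z - RtoC t)). split; [lra|].
  intros w Hw. exists t. split; [assumption|].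
  replace (w - RtoC t)%C with ((z - RtoC t) + (w - z))%C by ring.
  apply Rle_lt_trans with (1 := Cmod_triangle _ _). lra.
Qed.

Lemma nbh_II (d x : R) : 0 < d -> II x -> nbh d (RtoC x).
Proof.
  intros Hd Hx. exists x. split; [assumption|].
  replace (RtoC x - RtoC x)%C with (RtoC 0) by ring. now rewrite Cmod_0.
Qed.

Lemma nbh_le (d e : R) (z : C) : d <= e -> nbh d z -> nbh e z.
Proof. intros H [t [Ht Hz]]. exists t. split; [assumption|lra]. Qed.

(** Cauchy's estimate, applied [p] times with radius [d / (p + 1)]. *)
Lemma iter_deriv_bound (d M : R) (f : C -> C) :
  0 < d ->
  (forall z, nbh d z -> exists l, cderiv f z l) ->
  (forall z, nbh d z -> Cmod (f z) <= M) ->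
  forall p x, II x -> Cmod (iter_deriv p f (RtoC x)) <= M * (2 * INR (S p) / d) ^ p.
Proof.
  intros Hd Hf HM p x Hx.
  set (m := INR (S p)).
  assert (Hm : 0 < m) by (unfold m; apply lt_0_INR; lia).
  assert (Hdm : 0 < d / m) by (apply Rdiv_lt_0_compat; assumption).
  assert (HD := cderiv_iter_deriv (nbh d) f (nbh_open d) Hf).
  (* Each differentiation gives up a width [d / m]. Since [m] is [p + 1] and not [p], a
     neighbourhood of positive radius remains after [p] of them. *)
  assert (B : forall j, (j <= p)%nat -> forall z, nbh (d - INR j * (d / m)) z ->
     Cmod (iter_deriv j f z) <= M * (2 * m / d) ^ j).
  { induction j; intros Hj z Hz.
    - simpl. rewrite Rmult_1_r. apply HM. apply nbh_le with (2 := Hz). simpl; lra.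
    - assert (Pj : 0 <= INR j * (d / m)) by (apply Rmult_le_pos; [apply pos_INR|lra]).
      rewrite S_INR in Hz.
      assert (Hsub : forall w, Cmod (w - z) < d / m -> nbh (d - INR j * (d / m)) w).
      { intros w Hw. apply nbh_le with (2 := nbh_ball _ _ _ _ Hz Hw). lra. }
      apply Rle_trans with (2 / (d / m) * (M * (2 * m / d) ^ j)).
      + apply (cauchy_estimate (iter_deriv j f) z); [assumption| | |].
        * intros w Hw. exists (iter_deriv (S j) f w). apply HD.
          apply nbh_le with (2 := Hsub w Hw). lra.
        * apply HD. apply nbh_le with (2 := Hz). lra.
        * intros w Hw. apply IHj; [lia|]. now apply Hsub.
      + right. simpl. field. lra. }
  apply B; [lia|]. apply nbh_II; [|assumption].
  assert (E : d = m * (d / m)) by (field; lra).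
  rewrite E at 1. unfold m at 1. rewrite S_INR. lra.
Qed.

(** A remainder that is quadratic with an explicit constant can be summed over the terms of a
    series, which is how the sum gets differentiated in [gevrey_series]. *)
Lemma iter_deriv_taylor (d K : R) (f : C -> C) (p : nat) (x y : R) :
  0 < d ->
  (forall z, nbh d z -> exists l, cderiv f z l) ->
  (forall t, II t -> Cmod (iter_deriv (S (S p)) f (RtoC t)) <= K) ->
  II x -> II y ->
  Cmod (iter_deriv p f (RtoC y) - iter_deriv p f (RtoC x)
        - iter_deriv (S p) f (RtoC x) * RtoC (y - x)) <= 4 * K * (y - x) ^ 2.
Proof.
  intros Hd Hf HK Hx Hy.
  assert (HD := cderiv_iter_deriv (nbh d) f (nbh_open d) Hf).
  assert (Seg : forall a b t, 0 <= t <= 1 -> (RtoC a + RtoC t * (RtoC b - RtoC a) = RtoC (a + t * (b - a)))%C).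
  { intros a b t _. rewrite RtoC_plus, RtoC_mult, RtoC_minus. reflexivity. }
  assert (HI : forall a b t, 0 <= t <= 1 -> II a -> II b -> II (a + t * (b - a))).
  { unfold II. intros a b t Ht Ha Hb. nra. }
  assert (K0 : 0 <= K) by (apply Rle_trans with (2 := HK x Hx); apply Cmod_ge_0).
  rewrite RtoC_minus.
  replace (4 * K * (y - x) ^ 2) with (2 * (2 * K * Cmod (RtoC y - RtoC x)) * Cmod (RtoC y - RtoC x)).
  2: { rewrite <- RtoC_minus, Cmod_R, <- (pow2_abs (y - x)). ring. }
  apply taylor2_C. intros t Ht. rewrite Seg by assumption.
  split; [apply HD, nbh_II; auto|].
  apply Rle_trans with (2 * K * Cmod (RtoC (x + t * (y - x)) - RtoC x)).
  - apply (mean_value_C _ (iter_deriv (S (S p)) f)). intros s Hs.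
    rewrite Seg by assumption. split; [apply HD, nbh_II; auto|apply HK; auto].
  - rewrite <- !RtoC_minus, !Cmod_R.
    apply Rmult_le_compat_l; [lra|].
    replace (x + t * (y - x) - x) with (t * (y - x)) by ring.
    rewrite Rabs_mult, Rabs_pos_eq by lra. generalize (Rabs_pos (y - x)). nra.
Qed.

(** * Sums of k-sequences *)

Definition CSeries (c : nat -> C) : C :=
  (Series (fun j => fst (c j)), Series (fun j => snd (c j))).

Lemma ex_series_fst (c : nat -> C) (b : nat -> R) :
  (forall j, Cmod (c j) <= b j) -> ex_series b -> ex_series (fun j => fst (c j)).
Proof.
  intros H Hb. apply (ex_series_le (K:=R_AbsRing) (V:=R_CompleteNormedModule) _ b); [|assumption].
  intros j. apply Rle_trans with (2 := H j). apply Rabs_fst_le.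
Qed.

Lemma ex_series_snd (c : nat -> C) (b : nat -> R) :
  (forall j, Cmod (c j) <= b j) -> ex_series b -> ex_series (fun j => snd (c j)).
Proof.
  intros H Hb. apply (ex_series_le (K:=R_AbsRing) (V:=R_CompleteNormedModule) _ b); [|assumption].
  intros j. apply Rle_trans with (2 := H j). apply Rabs_snd_le.
Qed.

Lemma Rabs_Series_le (a b : nat -> R) :
  (forall j, Rabs (a j) <= b j) -> ex_series b -> Rabs (Series a) <= Series b.
Proof.
  intros H Hb.
  assert (Ha : ex_series (fun j => Rabs (a j))).
  { apply (ex_series_le (K:=R_AbsRing) (V:=R_CompleteNormedModule) _ b); [|assumption].
    intros j. unfold norm; simpl. unfold abs; simpl. rewrite Rabs_Rabsolu. apply H. }
  apply Rle_trans with (1 := Series_Rabs a Ha).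
  apply Series_le; [|assumption]. intros j. split; [apply Rabs_pos|apply H].
Qed.

Lemma Cmod_CSeries_le (c : nat -> C) (b : nat -> R) :
  (forall j, Cmod (c j) <= b j) -> ex_series b -> Cmod (CSeries c) <= 2 * Series b.
Proof.
  intros H Hb. apply Rle_trans with (1 := Cmod_le_Rabs _). simpl.
  assert (Rabs (Series (fun j => fst (c j))) <= Series b).
  { apply Rabs_Series_le; [|assumption]. intros j. apply Rle_trans with (2 := H j), Rabs_fst_le. }
  assert (Rabs (Series (fun j => snd (c j))) <= Series b).
  { apply Rabs_Series_le; [|assumption]. intros j. apply Rle_trans with (2 := H j), Rabs_snd_le. }
  lra.
Qed.

Lemma CSeries_taylor (a b c : nat -> C) (A B D : nat -> R) (h : R) :
  (forall j, Cmod (a j) <= A j) -> ex_series A ->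
  (forall j, Cmod (b j) <= B j) -> ex_series B ->
  (forall j, Cmod (c j) <= D j) -> ex_series D ->
  CSeries (fun j => a j - b j - c j * RtoC h)%C
  = (CSeries a - CSeries b - CSeries c * RtoC h)%C.
Proof.
  intros Ha HA Hb HB Hc HD.
  assert (a1 := ex_series_fst _ _ Ha HA). assert (a2 := ex_series_snd _ _ Ha HA).
  assert (b1 := ex_series_fst _ _ Hb HB). assert (b2 := ex_series_snd _ _ Hb HB).
  assert (c1 := ex_series_fst _ _ Hc HD). assert (c2 := ex_series_snd _ _ Hc HD).
  assert (K : forall x y z : nat -> R, ex_series x -> ex_series y -> ex_series z ->
    Series (fun j => x j - y j - h * z j) = Series x - Series y - h * Series z).
  { intros x y z Hx Hy Hz.
    rewrite (Series_minus (fun j => x j - y j)).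
    - rewrite Series_minus, Series_scal_l by assumption. reflexivity.
    - apply (ex_series_minus (K:=R_AbsRing) (V:=R_NormedModule)); assumption.
    - apply (ex_series_scal (K:=R_AbsRing) (V:=R_NormedModule) h). assumption. }
  unfold CSeries. apply injective_projections; simpl.
  - transitivity (Series (fun j => fst (a j) - fst (b j) - h * fst (c j))).
    + apply Series_ext. intros j. ring.
    + rewrite K by assumption. ring.
  - transitivity (Series (fun j => snd (a j) - snd (b j) - h * snd (c j))).
    + apply Series_ext. intros j. ring.
    + rewrite K by assumption. ring.
Qed.

Lemma sum_n_C (c : nat -> C) (n : nat) :
  @sum_n C_AbelianGroup c n = (sum_n (fun j => fst (c j)) n, sum_n (fun j => snd (c j)) n).
Proof.
  induction n.
  - rewrite !sum_O. apply surjective_pairing.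
  - rewrite !sum_Sn, IHn. reflexivity.
Qed.

Lemma is_series_CSeries (c : nat -> C) (b : nat -> R) :
  (forall j, Cmod (c j) <= b j) -> ex_series b ->
  @is_series C_AbsRing C_NormedModule c (CSeries c).
Proof.
  intros H Hb. apply filterlim_locally. intros eps.
  assert (S1 := Series_correct _ (ex_series_fst _ _ H Hb)).
  assert (S2 := Series_correct _ (ex_series_snd _ _ H Hb)).
  assert (E1 := proj1 (filterlim_locally _ _) S1 eps).
  assert (E2 := proj1 (filterlim_locally _ _) S2 eps).
  generalize (filter_and _ _ E1 E2). apply filter_imp. intros n [N1 N2].
  split.
  - change (ball (Series (fun j => fst (c j))) eps (fst (@sum_n C_AbelianGroup c n))).
    rewrite sum_n_C. exact N1.
  - change (ball (Series (fun j => snd (c j))) eps (snd (@sum_n C_AbelianGroup c n))).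
    rewrite sum_n_C. exact N2.
Qed.

(** With [q = p / k], this is the inequality [ln y <= y] at [y = c n / q], multiplied by [q] and
    exponentiated. *)
Lemma exp_mul_power_le (c k : R) (n p : nat) :
  0 < c -> 0 < k -> (1 <= n)%nat -> (1 <= p)%nat ->
  exp (- c * INR n) * Rpower (INR n) (1 / k) ^ p <= Rpower (INR p / (k * c)) (1 / k) ^ p.
Proof.
  intros Hc Hk Hn Hp.
  assert (Pn : 0 < INR n) by (apply lt_0_INR; lia).
  assert (Pp : 0 < INR p) by (apply lt_0_INR; lia).
  assert (Q : 0 < INR p / (k * c)) by (apply Rdiv_lt_0_compat; [assumption|nra]).
  assert (P : forall x, 0 < Rpower x (1 / k)) by (intros; apply exp_pos).
  rewrite <- !Rpower_pow, !Rpower_mult by apply P.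
  unfold Rpower. rewrite <- exp_plus.
  assert (L : forall y, 0 < y -> ln y <= y).
  { intros y Hy. rewrite <- (exp_ln y) at 2 by assumption.
    generalize (exp_ineq1_le (ln y)). lra. }
  assert (L2 := L (INR n * / (INR p / (k * c)))).
  rewrite ln_mult, ln_Rinv in L2 by (try apply Rinv_0_lt_compat; assumption).
  specialize (L2 ltac:(apply Rmult_lt_0_compat; [|apply Rinv_0_lt_compat]; assumption)).
  assert (G : - c * INR n + 1 / k * INR p * ln (INR n) <= 1 / k * INR p * ln (INR p / (k * c))).
  { assert (0 < 1 / k * INR p) by (apply Rmult_lt_0_compat; [apply Rdiv_lt_0_compat; lra|assumption]).
    apply Rmult_le_compat_l with (r := 1 / k * INR p) in L2; [|lra].
    replace (1 / k * INR p * (INR n * / (INR p / (k * c)))) with (c * INR n) in L2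
      by (field; repeat split; lra).
    lra. }
  destruct G as [G|G]; [left; now apply exp_increasing|right; now rewrite G].
Qed.

(** The factor [4 / B] comes from Cauchy's [2 (p + 1) / B] and [p + 1 <= 2 p]. The power comes from
    [exp_mul_power_le] with [c = - ln (sqrt theta)]. *)
Definition gevrey_rate (k B theta : R) : R :=
  4 / B * Rpower (/ (k * - ln (sqrt theta))) (1 / k).

Lemma gevrey_term_le (k B theta : R) (n p : nat) :
  0 < k -> 0 < B -> 0 < theta < 1 -> (1 <= n)%nat ->
  theta ^ n * (2 * INR (S p) / (B * Rpower (INR n) (- (1 / k)))) ^ p
  <= gevrey_rate k B theta ^ p * Rpower (INR p) (INR p * (1 + 1 / k)) * sqrt theta ^ n.
Proof.
  intros Hk HB Ht Hn.
  set (eta := sqrt theta).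
  assert (He0 : 0 < eta) by (apply sqrt_lt_R0; lra).
  assert (Hee : eta * eta = theta) by (apply sqrt_sqrt; lra).
  assert (He1 : eta < 1) by nra.
  assert (Pe : 0 < eta ^ n) by (apply pow_lt; assumption).
  assert (Pe1 : eta ^ n <= 1) by (rewrite <- (pow1 n); apply pow_incr; lra).
  replace (theta ^ n) with (eta ^ n * eta ^ n) by (rewrite <- Rpow_mult_distr, Hee; reflexivity).
  (* The inequality [p + 1 <= 2 p] fails for [p = 0]; there both powers are 1 and [Rpower 0 0] is
     1. *)
  destruct (Nat.eq_dec p 0) as [->|Np].
  { simpl. rewrite Rmult_0_l. unfold Rpower at 1. rewrite Rmult_0_l, exp_0. nra. }
  assert (Hp : (1 <= p)%nat) by lia.
  set (c := - ln eta).
  assert (Hc : 0 < c). { unfold c. rewrite <- ln_1. generalize (ln_increasing eta 1 He0 He1). rewrite ln_1. lra. }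
  assert (Een : eta ^ n = exp (- c * INR n)).
  { rewrite <- Rpower_pow by assumption. unfold Rpower, c. f_equal. ring. }
  assert (Pn : 0 < INR n) by (apply lt_0_INR; lia).
  assert (Pp : 1 <= INR p) by (apply (le_INR 1); lia).
  assert (X := exp_mul_power_le c k n p Hc Hk Hn Hp). rewrite <- Een in X.
  assert (P : forall x, 0 < Rpower x (1 / k)) by (intros; apply exp_pos).
  replace (2 * INR (S p) / (B * Rpower (INR n) (- (1 / k))))
    with (Rpower (INR n) (1 / k) * (2 * INR (S p) / B)).
  2: { rewrite Rpower_Ropp. generalize (P (INR n)). intros. field. lra. }
  rewrite Rpow_mult_distr.
  unfold gevrey_rate. fold eta. fold c.
  replace (Rpower (INR p) (INR p * (1 + 1 / k))) with (INR p ^ p * Rpower (INR p) (1 / k) ^ p).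
  2: { rewrite <- (Rpower_pow p (Rpower _ _)), Rpower_mult by apply P.
       rewrite <- Rpower_pow, <- Rpower_plus by lra. f_equal. ring. }
  replace ((4 / B * Rpower (/ (k * c)) (1 / k)) ^ p * (INR p ^ p * Rpower (INR p) (1 / k) ^ p))
    with (Rpower (INR p / (k * c)) (1 / k) ^ p * (4 * INR p / B) ^ p).
  2: { unfold Rdiv at 1. rewrite <- Rpower_mult_distr.
       - rewrite <- !Rpow_mult_distr. f_equal. field. lra.
       - lra.
       - apply Rinv_0_lt_compat. nra. }
  (* Cauchy's factor yields the part [p ^ p] of the Gevrey bound; [X] yields the part [p^(p/k)]. *)
  assert (Y : (2 * INR (S p) / B) ^ p <= (4 * INR p / B) ^ p).
  { apply pow_incr. rewrite S_INR. split.
    - apply Rdiv_le_0_compat; lra.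
    - apply Rmult_le_compat_r; [left; now apply Rinv_0_lt_compat|lra]. }
  assert (Y0 : 0 <= (2 * INR (S p) / B) ^ p).
  { apply pow_le, Rdiv_le_0_compat; [|assumption]. rewrite S_INR. lra. }
  apply Rle_trans with (eta ^ n * Rpower (INR n) (1 / k) ^ p * (2 * INR (S p) / B) ^ p * eta ^ n).
  { right. ring. }
  apply Rmult_le_compat_r; [lra|].
  apply Rmult_le_compat; try assumption.
  apply Rmult_le_pos; [lra|]. apply pow_le. generalize (P (INR n)); lra.
Qed.

Lemma filterdiff_within_II (F : R -> C) (x : R) (l : C) (K : R) :
  II x -> 0 <= K ->
  (forall y, II y -> Cmod (F y - F x - l * RtoC (y - x)) <= K * (y - x) ^ 2) ->
  @filterdiff R_AbsRing R_NormedModule C_R_NormedModule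
    F (within II (locally x)) (fun y : R => @scal R_Ring C_R_ModuleSpace y l).
Proof.
  intros Hx HK H. split.
  - apply (is_linear_scal_l (K:=R_AbsRing) (V:=C_R_NormedModule) l).
  - intros x' Hx'.
    (* [filterdiff] quantifies over every limit point of the filter. As [x] is in [II], each set of
       [within II (locally x)] contains [x], so a ball around another point that excludes [x] cannot
       belong to it. *)
    assert (E : x' = x).
    { apply NNPP. intros Hn.
      assert (Hd : 0 < Rabs (x - x')) by (apply Rabs_pos_lt; lra).
      assert (L := Hx' (fun y => ball x' (mkposreal _ Hd) y) (locally_ball _ _)).
      apply locally_singleton in L. specialize (L Hx).
      revert L. apply Rlt_irrefl. }
    subst x'. clear Hx'.
    intros eps.
    assert (He : 0 < eps / (K + 1)) by (apply Rdiv_lt_0_compat; [apply cond_pos|lra]).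
    exists (mkposreal _ He). intros y Hy Iy.
    change (Rabs (y - x) < eps / (K + 1)) in Hy.
    change (@norm R_AbsRing R_NormedModule (minus y x)) with (Rabs (y - x)).
    rewrite norm_C_R.
    assert (A0 := Rabs_pos (y - x)).
    apply Rle_trans with (K * (y - x) ^ 2).
    + apply Rle_trans with (2 := H y Iy). right. f_equal.
      apply injective_projections; simpl;
      unfold scal, minus, plus, opp; simpl; unfold mult; simpl; ring.
    + rewrite <- pow2_abs. apply Rle_trans with ((K + 1) * Rabs (y - x) * Rabs (y - x)).
      * nra.
      * apply Rmult_le_compat_r; [assumption|].
        replace (pos eps) with ((K + 1) * (eps / (K + 1))) by (field; lra).
        apply Rmult_le_compat_l; lra.
Qed.

(** For each order [p] the derivatives of the terms are dominated by a geometric series [b p]. The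
    domination for [p], [p + 1] and [p + 2] justifies one more termwise differentiation, and the sum
    of [b p] is the Gevrey bound. *)
Lemma gevrey_series (k B M theta : R) (g : nat -> C -> C) (v : R -> C) :
  0 < k -> 0 < B -> 0 < M -> 0 < theta < 1 ->
  (forall n z, nbh (B * Rpower (INR (S n)) (- (1 / k))) z -> exists l, cderiv (g n) z l) ->
  (forall n z, nbh (B * Rpower (INR (S n)) (- (1 / k))) z -> Cmod (g n z) <= M * theta ^ (S n)) ->
  (forall x, II x -> v x = CSeries (fun n => g n (RtoC x))) ->
  gevrey k v.
Proof.
  intros Hk HB HM Ht Hg Hb Hv.
  set (eta := sqrt theta).
  assert (He0 : 0 < eta) by (apply sqrt_lt_R0; lra).
  assert (Hee : eta * eta = theta) by (apply sqrt_sqrt; lra).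
  assert (He1 : eta < 1) by nra.
  assert (Hgeo : ex_series (fun n => eta ^ n)) by (apply ex_series_geom; rewrite Rabs_pos_eq; lra).
  pose (A := gevrey_rate k B theta).
  assert (HA : 0 < A).
  { apply Rmult_lt_0_compat; [apply Rdiv_lt_0_compat; lra|apply exp_pos]. }
  (* The last factor [eta] is due to the shift of indices: [g n] is the term of index [S n], bounded
     with [eta ^ S n]. *)
  pose (W := fun p => M * A ^ p * Rpower (INR p) (INR p * (1 + 1 / k)) * eta).
  assert (HW : forall p, 0 < W p).
  { intros p. unfold W. repeat apply Rmult_lt_0_compat; try assumption.
    - now apply pow_lt.
    - apply exp_pos. }
  pose (b := fun p n => W p * eta ^ n).
  assert (Hexb : forall p, ex_series (b p)).
  { intros p. apply (ex_series_scal (K:=R_AbsRing) (V:=R_NormedModule) (W p)). assumption. }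
  assert (Hr : forall n, 0 < B * Rpower (INR (S n)) (- (1 / k))).
  { intros n. apply Rmult_lt_0_compat; [assumption|apply exp_pos]. }
  assert (HD : forall p x, II x -> forall n, Cmod (iter_deriv p (g n) (RtoC x)) <= b p n).
  { intros p x Hx n.
    apply Rle_trans with (1 := iter_deriv_bound _ _ (g n) (Hr n) (Hg n) (Hb n) p x Hx).
    rewrite Rmult_assoc.
    apply Rle_trans with (M * (A ^ p * Rpower (INR p) (INR p * (1 + 1 / k)) * eta ^ S n)).
    - apply Rmult_le_compat_l; [lra|]. apply gevrey_term_le; try assumption. lia.
    - right. unfold b, W. simpl. ring. }
  pose (F := fun p x => CSeries (fun n => iter_deriv p (g n) (RtoC x))).
  assert (HG : forall p, Series (b p) = W p * / (1 - eta)).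
  { intros p. unfold b. rewrite Series_scal_l, Series_geom; [reflexivity|rewrite Rabs_pos_eq; lra]. }
  exists F. split; [split|].
  - intros x Hx. now rewrite Hv.
  - intros p x Hx.
    (* The 4 comes from [iter_deriv_taylor], the 2 from [Cmod_CSeries_le]. *)
    apply filterdiff_within_II with (K := 2 * (4 * Series (b (S (S p))))).
    + assumption.
    + rewrite HG. assert (0 < / (1 - eta)) by (apply Rinv_0_lt_compat; lra).
      generalize (HW (S (S p))). nra.
    + intros y Hy. unfold F.
      rewrite <- (CSeries_taylor _ _ _ (b p) (b p) (b (S p))); try apply Hexb; try (now apply HD).
      replace (2 * (4 * Series (b (S (S p)))) * (y - x) ^ 2)
        with (2 * Series (fun n => (4 * (y - x) ^ 2) * b (S (S p)) n))
        by (rewrite Series_scal_l; ring).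
      apply Cmod_CSeries_le.
      * intros n. replace (4 * (y - x) ^ 2 * b (S (S p)) n) with (4 * b (S (S p)) n * (y - x) ^ 2) by ring.
        apply (iter_deriv_taylor _ _ (g n) p x y (Hr n) (Hg n)); try assumption.
        intros t It. now apply HD.
      * apply (ex_series_scal (K:=R_AbsRing) (V:=R_NormedModule) (4 * (y - x) ^ 2)). apply Hexb.
  - exists (2 * (M * eta * / (1 - eta))), A. split; [|split; [assumption|]].
    + assert (0 < / (1 - eta)) by (apply Rinv_0_lt_compat; lra).
      apply Rmult_lt_0_compat; [lra|]. apply Rmult_lt_0_compat; [|assumption]. nra.
    + intros p. apply Lub_Rbar_correct. intros r [x [Hx ->]]. simpl.
      apply Rle_trans with (2 * Series (b p)).
      * apply Cmod_CSeries_le; [now apply HD|apply Hexb].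
      * right. rewrite HG. unfold W. ring.
Qed.

(** * Tubes and iterates of [T] *)

Lemma tube_nbh (k A : R) (n : nat) (z : C) :
  tube k A n z <-> nbh (A * Rpower (INR n) (- (1 / k))) z.
Proof.
  unfold tube, nbh.
  set (d := A * Rpower (INR n) (- (1 / k))).
  set (E := fun r => exists t, II t /\ r = Cmod (z - RtoC t)%C).
  destruct (Glb_Rbar_correct E) as [Hlb Hglb]. split.
  - intros H. apply NNPP. intros N.
    apply (Rbar_lt_not_le _ _ H). apply Hglb.
    intros r [t [Ht ->]]. simpl. apply Rnot_lt_le. intros L. apply N. now exists t.
  - intros [t [Ht L]]. apply Rbar_le_lt_trans with (Finite (Cmod (z - RtoC t))).
    + apply Hlb. now exists t.
    + exact L.
Qed.

Lemma holo_cderiv (S : C -> Prop) (f : C -> C) :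
  holo S f <-> exists U : C -> Prop,
    (forall z, U z -> exists d, 0 < d /\ forall w, Cmod (w - z) < d -> U w) /\
    (forall z, S z -> U z) /\ (forall z, U z -> exists l, cderiv f z l).
Proof.
  split; intros [U [HU [HS HD]]]; exists U; (split; [now apply open_Cmod|split; [assumption|]]);
  intros z Hz; destruct (HD z Hz) as [l Hl]; exists l; now apply is_derive_cderiv.
Qed.

(** A tube is open, so it can itself be the neighbourhood that [holo] asks for. *)
Lemma holo_tube (k A : R) (n : nat) (f : C -> C) :
  holo (tube k A n) f <->
  forall z, nbh (A * Rpower (INR n) (- (1 / k))) z -> exists l, cderiv f z l.
Proof.
  rewrite holo_cderiv. split.
  - intros [U [_ [HS HD]]] z Hz. apply HD, HS. now apply tube_nbh.
  - intros H. exists (nbh (A * Rpower (INR n) (- (1 / k)))).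
    split; [apply nbh_open|split; [|exact H]]. intros z Hz. now apply tube_nbh.
Qed.

Lemma holo_subset (S S' : C -> Prop) (f : C -> C) :
  (forall z, S' z -> S z) -> holo S f -> holo S' f.
Proof. intros H [U [HU [HS HD]]]. exists U. auto. Qed.

Lemma IC_tube (k A : R) (n : nat) (z : C) : 0 < A -> IC z -> tube k A n z.
Proof.
  intros HA [t [Ht ->]]. apply tube_nbh, nbh_II; [|assumption].
  apply Rmult_lt_0_compat; [assumption|apply exp_pos].
Qed.

Lemma sup_norm_le {X : Type} (S : X -> Prop) (f : X -> C) (c : R) :
  Rbar_le (sup_norm S f) (Finite c) <-> forall x, S x -> Cmod (f x) <= c.
Proof.
  unfold sup_norm. set (E := fun r => exists x, S x /\ r = Cmod (f x)).
  destruct (Lub_Rbar_correct E) as [Hub Hlub]. split.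
  - intros H x Hx. apply (Rbar_le_trans (Finite (Cmod (f x))) (Lub_Rbar E) (Finite c)).
    + apply Hub. now exists x.
    + exact H.
  - intros H. apply Hlub. intros r [x [Hx ->]]. now apply H.
Qed.

Lemma Rbar_mult_le_Finite (a c : R) (s : Rbar) :
  0 < a -> Rbar_le s (Finite c) -> Rbar_le (Rbar_mult (Finite a) s) (Finite (a * c)).
Proof.
  intros Ha H. destruct s as [s| |].
  - simpl in *. apply Rmult_le_compat_l; lra.
  - contradiction.
  - unfold Rbar_mult, Rbar_mult'. destruct (Rle_dec 0 a) as [L|L]; [|lra].
    destruct (Rle_lt_or_eq_dec 0 a L); [exact I|lra].
Qed.

Lemma germ_eq_refl (f : C -> C) : germ_eq f f.
Proof.
  exists (fun _ => True). split; [apply open_true|]. auto.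
Qed.

Lemma germ_eq_trans (f g h : C -> C) : germ_eq f g -> germ_eq g h -> germ_eq f h.
Proof.
  intros [U [HU [IU EU]]] [V [HV [IV EV]]].
  exists (fun z => U z /\ V z). split; [now apply open_and|]. split; [auto|].
  intros z [Uz Vz]. rewrite EU, EV; auto.
Qed.

Lemma germ_eq_II (f g : C -> C) (x : R) : germ_eq f g -> II x -> f (RtoC x) = g (RtoC x).
Proof. intros [U [_ [IU EU]]] Hx. apply EU, IU. now exists x. Qed.

Lemma holo_bounded_nbh (u : C -> C) :
  holo IC u -> exists d M, 0 < d /\ 0 < M /\
    forall z, nbh d z -> (exists l, cderiv u z l) /\ Cmod (u z) <= M.
Proof.
  intros H. apply holo_cderiv in H. destruct H as [U [HU [HI HD]]].
  (* One number [e] encodes both a radius and the bound [/ e], because the compactness argument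
     handles a single gauge. The radius [2 * e] leaves room to replace the centre [t] by a point at
     distance less than [e]. *)
  assert (Loc : forall t, exists e : posreal, II t ->
     forall z, Cmod (z - RtoC t) < 2 * e -> (exists l, cderiv u z l) /\ Cmod (u z) <= / e).
  { intros t. destruct (classic (II t)) as [Ht|Ht].
    2: { exists (mkposreal 1 Rlt_0_1). contradiction. }
    assert (Ut : U (RtoC t)) by (apply HI; now exists t).
    destruct (HU _ Ut) as [d1 [Hd1 H1]].
    destruct (HD _ Ut) as [l Hl].
    destruct (cderiv_ccontC _ _ _ Hl 1 Rlt_0_1) as [d2 [Hd2 H2]].
    set (m := 1 + Cmod (u (RtoC t))).
    assert (Hm : 0 < m) by (unfold m; generalize (Cmod_ge_0 (u (RtoC t))); lra).
    set (e := Rmin (Rmin d1 d2 / 2) (/ m)).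
    assert (He : 0 < e).
    { unfold e. apply Rmin_pos; [|now apply Rinv_0_lt_compat].
      generalize (Rmin_pos d1 d2 Hd1 Hd2). lra. }
    exists (mkposreal e He). intros _ z Hz. simpl in *.
    assert (E1 : e <= Rmin d1 d2 / 2) by apply Rmin_l.
    assert (E2 : e <= / m) by apply Rmin_r.
    generalize (Rmin_l d1 d2) (Rmin_r d1 d2). intros R1 R2.
    split.
    - apply HD, H1. lra.
    - apply Rle_trans with m.
      + replace (u z) with ((u z - u (RtoC t)) + u (RtoC t))%C by ring.
        apply Rle_trans with (1 := Cmod_triangle _ _).
        specialize (H2 z ltac:(lra)). unfold m. lra.
      + rewrite <- (Rinv_inv m). apply Rinv_le_contravar; assumption. }
  pose (delta := fun t => proj1_sig (constructive_indefinite_description _ (Loc t))).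
  assert (Hdelta := fun t => proj2_sig (constructive_indefinite_description _ (Loc t))).
  (* Every [x] in [[-1,1]] is within [delta t] of some [t] with [d <= delta t]. A point within [d]
     of [x] is then within [2 * delta t] of [t], and [/ delta t <= / d]. *)
  destruct (compactness_value_1d (-1) 1 delta) as [d Hd].
  exists d, (/ d). split; [apply cond_pos|split; [apply Rinv_0_lt_compat, cond_pos|]].
  intros z [x [Hx Hz]]. apply NNPP. intros N. apply (Hd x Hx).
  intros [t [Ht [Hxt Hdt]]]. apply N.
  destruct (Hdelta t Ht z) as [D B].
  - fold (delta t). replace (z - RtoC t)%C with ((z - RtoC x) + RtoC (x - t))%C
      by (rewrite RtoC_minus; ring).
    apply Rle_lt_trans with (1 := Cmod_triangle _ _). rewrite Cmod_R. lra.
  - split; [exact D|]. apply Rle_trans with (1 := B). fold (delta t).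
    apply Rinv_le_contravar; [apply cond_pos|exact Hdt].
Qed.

(** The iterates are only germs, while (ii) bounds functions on tubes; [g j] is a representative of
    the [j]-th iterate that is holomorphic on the whole tube. *)
Lemma iterates_on_tubes (k : R) (T : (C -> C) -> (C -> C)) (u : C -> C) :
  0 < k -> germ_endomorphism T -> A_property k T -> holo IC u ->
  exists (A M rho : R) (N : nat) (g : nat -> C -> C),
    0 < A /\ 0 < M /\ 0 < rho < 1 /\ (1 <= N)%nat /\
    forall j, germ_on (tube k A (N + j)) (Nat.iter j T u) (g j) /\
      forall z, tube k A (N + j) z -> Cmod (g j z) <= M * rho ^ j.
Proof.
  intros Hk [Tholo [Tcong _]] [tau [rho [Htau [Hrho [HA _]]]]] Hu.
  destruct (holo_bounded_nbh u Hu) as [d [M [Hd [HM HB]]]].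
  assert (Amin : 0 < Rmin tau d) by (now apply Rmin_pos).
  (* [N] is known only after [A]. But the radius [A N^(-1/k)] is at most [A <= d] for any [N >= 1],
     so [u] is holomorphic and bounded by [M] on the first tube whatever [N] is. *)
  set (A := Rmin tau d) in *.
  destruct (HA A (conj Amin (Rmin_l _ _))) as [N [HN [Hi Hii]]].
  assert (Hiter : forall j, holo IC (Nat.iter j T u)).
  { induction j; simpl; [assumption|]. now apply Tholo. }
  assert (HT : forall z, tube k A N z -> nbh d z).
  { intros z Hz. apply tube_nbh in Hz. apply nbh_le with (2 := Hz).
    apply Rle_trans with (A * 1); [|rewrite Rmult_1_r; apply Rmin_r].
    apply Rmult_le_compat_l; [lra|].
    rewrite Rpower_Ropp. apply Rle_trans with (/ 1); [|lra].
    apply Rinv_le_contravar; [lra|].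
    assert (1 <= INR N) by (apply (le_INR 1); lia).
    apply Rle_trans with (Rpower (INR N) 0); [rewrite Rpower_O; lra|].
    apply Rle_Rpower; [assumption|]. left. apply Rdiv_lt_0_compat; lra. }
  assert (G : forall j, exists g, germ_on (tube k A (N + j)) (Nat.iter j T u) g /\
      forall z, tube k A (N + j) z -> Cmod (g z) <= M * rho ^ j).
  { induction j as [|j [g [[Hg Eg] Bg]]].
    - exists u. rewrite Nat.add_0_r. simpl. rewrite Rmult_1_r. split; [split|].
      + apply holo_tube. intros z Hz. apply HB, HT. now apply tube_nbh.
      + apply germ_eq_refl.
      + intros z Hz. apply HB, HT, Hz.
    - assert (Hg' : holo IC g).
      { apply holo_subset with (2 := Hg). intros z. now apply IC_tube. }
      (* Property (i) is applied to the representative [g]; since [T] respects germs, the result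
         still represents the next iterate. *)
      destruct (Hi (N + j)%nat ltac:(lia) g Hg) as [g' Hg2].
      exists g'. rewrite Nat.add_succ_r. split; [split|].
      + apply Hg2.
      + apply germ_eq_trans with (T g); [|apply Hg2].
        simpl. apply Tcong; auto.
      + apply sup_norm_le.
        apply Rbar_le_trans with (1 := Hii (N + j)%nat ltac:(lia) g g' Hg Hg2).
        replace (M * rho ^ S j) with (rho * (M * rho ^ j)) by (simpl; ring).
        apply Rbar_mult_le_Finite; [lra|]. now apply sup_norm_le. }
  pose (g := fun j => proj1_sig (constructive_indefinite_description _ (G j))).
  exists A, M, rho, N, g. repeat (split; [assumption|]).
  intros j. exact (proj2_sig (constructive_indefinite_description _ (G j))).
Qed.

(** [N + n <= N (n + 1)]. *)
Lemma tube_shift (k A : R) (N n : nat) (z : C) :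
  0 < k -> 0 < A -> (1 <= N)%nat ->
  tube k (A * Rpower (INR N) (- (1 / k))) (S n) z -> tube k A (N + n) z.
Proof.
  intros Hk HA HN Hz. apply tube_nbh. apply tube_nbh in Hz.
  apply nbh_le with (2 := Hz). rewrite Rmult_assoc. apply Rmult_le_compat_l; [lra|].
  assert (P1 : 0 < INR N) by (apply lt_0_INR; lia).
  assert (P2 : 0 < INR (S n)) by (apply lt_0_INR; lia).
  rewrite Rpower_mult_distr by assumption.
  rewrite !Rpower_Ropp. apply Rinv_le_contravar; [apply exp_pos|].
  apply Rle_Rpower_l; [left; apply Rdiv_lt_0_compat; lra|].
  split; [apply lt_0_INR; lia|]. rewrite <- mult_INR. apply le_INR. nia.
Qed.

Lemma Cmod_sum_n_tail (c : nat -> C) (M rho : R) (n : nat) :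
  0 < rho < 1 -> (forall j, Cmod (c j) <= M * rho ^ j) ->
  Cmod (@sum_n C_AbelianGroup c n - CSeries c)%C <= 2 * (M * / (1 - rho)) * rho ^ S n.
Proof.
  intros Hrho Hc.
  assert (Hgeo : ex_series (fun n => rho ^ n)) by (apply ex_series_geom; rewrite Rabs_pos_eq; lra).
  assert (HM : ex_series (fun n => M * rho ^ n)).
  { apply (ex_series_scal (K:=R_AbsRing) (V:=R_NormedModule) M). assumption. }
  replace (@sum_n C_AbelianGroup c n - CSeries c)%C with (- CSeries (fun j => c (S n + j)%nat))%C.
  - rewrite Cmod_opp.
    replace (2 * (M * / (1 - rho)) * rho ^ S n) with (2 * Series (fun j => M * rho ^ S n * rho ^ j)).
    + apply Cmod_CSeries_le.
      * intros j. rewrite Rmult_assoc, <- pow_add. apply Hc.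
      * apply (ex_series_scal (K:=R_AbsRing) (V:=R_NormedModule) (M * rho ^ S n)). assumption.
    + rewrite Series_scal_l, Series_geom by (rewrite Rabs_pos_eq; lra). ring.
  - rewrite sum_n_C. unfold CSeries.
    rewrite (Series_incr_n (fun j => fst (c j)) (S n)) by (lia || exact (ex_series_fst _ _ Hc HM)).
    rewrite (Series_incr_n (fun j => snd (c j)) (S n)) by (lia || exact (ex_series_snd _ _ Hc HM)).
    rewrite !sum_n_Reals. apply injective_projections; simpl; ring.
Qed.

Theorem theorem3 :
  forall (k : R) (T : (C -> C) -> (C -> C)) (Tt : (R -> C) -> (R -> C)),
    0 < k ->
    germ_endomorphism T ->
    A_property k T ->
    induced_endomorphism k T Tt ->
    forall u : C -> C, holo IC u ->
      exists v : R -> C,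
        series_cvu_on_II (fun n => restr (Nat.iter n T u)) v /\
        gevrey k v /\
        (forall x : R, II x -> (v x - Tt v x)%C = restr u x).
Proof.
  intros k T Tt Hk HT HA [_ HTt] u Hu.
  destruct (iterates_on_tubes k T u Hk HT HA Hu) as [A [M [rho [N [g [PA [PM [Hrho [HN Hg]]]]]]]]].
  set (B := A * Rpower (INR N) (- (1 / k))).
  assert (HB : 0 < B) by (apply Rmult_lt_0_compat; [assumption|apply exp_pos]).
  (* Sequences are indexed from 1, so the iterate of order [n] is the term of index [S n] and its
     bound is rewritten with [rho ^ S n]. *)
  assert (Mrho : forall n, M * rho ^ n = M / rho * rho ^ S n) by (intros; simpl; field; lra).
  assert (PMr : 0 < M / rho) by (apply Rdiv_lt_0_compat; lra).
  assert (Eg : forall n x, II x -> restr (Nat.iter n T u) x = g n (RtoC x)).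
  { intros n x Hx. apply germ_eq_II; [apply Hg|assumption]. }
  assert (Bd : forall x, II x -> forall n, Cmod (restr (Nat.iter n T u) x) <= M * rho ^ n).
  { intros x Hx n. rewrite Eg by assumption. apply Hg. apply IC_tube; [assumption|]. now exists x. }
  assert (HM : ex_series (fun n => M * rho ^ n)).
  { apply (ex_series_scal (K:=R_AbsRing) (V:=R_NormedModule) M).
    apply ex_series_geom; rewrite Rabs_pos_eq; lra. }
  pose (v := fun x => CSeries (fun n => restr (Nat.iter n T u) x)).
  exists v. split; [|split].
  - intros eps Heps.
    set (K := 2 * (M * / (1 - rho))).
    assert (PK : 0 < K).
    { assert (0 < / (1 - rho)) by (apply Rinv_0_lt_compat; lra). unfold K. nra. }
    destruct (pow_lt_1_zero rho) with (y := eps / K) as [n0 Hn0].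
    { rewrite Rabs_pos_eq; lra. } { now apply Rdiv_lt_0_compat. }
    exists n0. intros n Hn x Hx.
    apply Rle_lt_trans with (1 := Cmod_sum_n_tail _ M rho n Hrho (Bd x Hx)).
    fold K. specialize (Hn0 (S n) ltac:(lia)).
    rewrite Rabs_pos_eq in Hn0 by (apply pow_le; lra).
    apply Rmult_lt_compat_l with (r := K) in Hn0; [|assumption].
    replace (K * (eps / K)) with eps in Hn0 by (field; lra). exact Hn0.
  - apply (gevrey_series k B (M / rho) rho g); try assumption.
    + intros n z Hz. apply (proj1 (holo_tube k A (N + n) (g n))); [apply Hg|].
      apply tube_nbh, tube_shift; try assumption. now apply tube_nbh.
    + intros n z Hz. rewrite <- Mrho. apply Hg.
      apply tube_shift; try assumption. now apply tube_nbh.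
    + intros x Hx. unfold v, CSeries.
      f_equal; apply Series_ext; intros n; now rewrite Eg.
  - intros x Hx.
    (* [f (S n)] reduces to the [n]-th iterate; the ignored value [f 0] is [u] as well. *)
    pose (f := fun n => Nat.iter (Nat.pred n) T u).
    assert (Sv : sums_to f v).
    { intros y Hy. exact (is_series_CSeries _ _ (Bd y Hy) HM). }
    assert (kf : k_sequence k f).
    { exists B, (M / rho), rho. repeat (split; [assumption|]).
      intros n Hn. destruct n as [|n]; [lia|]. exists (g n).
      destruct (Hg n) as [[G1 G2] G3].
      split; [split|].
      - apply holo_subset with (2 := G1). intros z. now apply tube_shift.
      - exact G2.
      - rewrite <- Mrho. apply sup_norm_le. intros z Hz. apply G3. now apply tube_shift. }
    assert (S1 := HTt f v kf Sv x Hx). assert (S0 := Sv x Hx).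
    (* [T (f (S n))] is the iterate of order [n + 1], so the series that converges to [Tt v] is that
       of [v] without its first term [u]. Uniqueness of limits concludes. *)
    assert (S2 : @is_series C_AbsRing C_NormedModule
       (fun n => restr (T (f (S n))) x) (v x - restr u x)%C).
    { apply (@is_series_incr_1 C_AbsRing C_NormedModule (fun n => restr (f (S n)) x)).
      assert (E0 : v x = (v x - restr u x + restr u x)%C) by ring.
      rewrite E0 in S0. exact S0. }
    assert (E : Tt v x = (v x - restr u x)%C).
    { exact (filterlim_locally_unique (V:=C_NormedModule) _ _ _ S1 S2). }
    rewrite E. ring.
Qed.
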